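(* There exists an absolute constant $K>0$ such that the following holds. Let $\mathcal{F}$ be a set of measurable real-valued functions defined on a measurable space $S$, and let $X_1,\dots,X_n$ be i.i.d. copies of an $S$-valued random variable $X$. Assume that $\mathbb{E}f(X)=0$ for all $f\in\mathcal{F}$. Set $F(x)=\sup_{f\in\mathcal{F}}|f(x)|$, $M=\max_{1\le k\le n}F(X_k)$, and suppose that $\mathbb{E}M^p<\infty$ for some $p\ge2$. Let $Z=\sup_{f\in\mathcal{F}}\sum_{k=1}^nf(X_k)$, assumed to be measurable, and let $\sigma_*>0$ or $\sigma_*=0$ be such that $\sigma_*^2\ge n\sup_{f\in\mathcal{F}}\mathbb{E}f^2(X)$. Then for all $t>0$ with $t\ge\sqrt2\,\sigma_*$, $$\mathbb{P}\big(Z>24(\mathbb{E}Z+t)\big)\le K\left(\exp\left(-\frac{t^2}{2\sigma_*^2+64\,t\,\mathbb{E}M}\right)+\mathbb{P}(M\ge t)+\left(\frac{p}{\log(ep)}\right)^{2p}\left(\frac{\mathbb{E}M^p}{t^p}\right)^2\right).$$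
   Context: ''Absolute constant'' is understood as in the paper: $K$ is a numerical constant. Measurability of $M$ is implicitly assumed, along with that of $Z$.
   Formalization: M and Z are assumed measurable as functions of the sample (x_1,…,x_n) on S^n with the product sigma-algebra; measurability only on the underlying probability space would make the claim false for some uncountable classes. *)

(* Defs.v *)
From HB Require Import structures.
From mathcomp Require Import all_boot all_order all_algebra.
From mathcomp Require Import all_classical all_reals all_analysis.
From mathcomp Require Import measurable_realfun.
Import Order.TTheory GRing.Theory Num.Theory.
Import numFieldNormedType.Exports.
Set Implicit Arguments.
Unset Strict Implicit.
Unset Printing Implicit Defensive.
Local Open Scope classical_set_scope.
Local Open Scope ring_scope.
Local Open Scope ereal_scope.

Section defs.
Context (d d' : measure_display) (T : measurableType d)
  (S : measurableType d') (R : realType) (P : probability T R).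

(* The rule for a subfamily of indices is the case A k = setT off it. *)
Definition mutually_independent (n : nat) (X_ : 'I_n -> {RV P >-> S}) : Prop :=
  forall A : 'I_n -> set S, (forall k, measurable (A k)) ->
    P [set w | forall k, A k (X_ k w)] =
    \big[*%E/1]_(k < n) P (X_ k @^-1` A k).

Definition identically_distributed (X Y : {RV P >-> S}) : Prop :=
  forall A : set S, measurable A -> distribution P X A = distribution P Y A.

Definition iid_copies (n : nat) (X : {RV P >-> S})
    (X_ : 'I_n -> {RV P >-> S}) : Prop :=
  mutually_independent X_ /\ (forall k, identically_distributed (X_ k) X).

Definition sample (n : nat) (X_ : 'I_n -> {RV P >-> S}) (w : T) : n.-tuple S :=
  [tuple X_ k w | k < n].

(* Suprema are taken in \bar R: the class F may be uncountable, and nothing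
   bounds it at individual points of S. *)
Definition envelope (F : set (S -> R)) (x : S) : \bar R :=
  ereal_sup [set (`|f x|%R)%:E | f in F].

(* The maximum and the supremum below are functionals on the product space S^n
   (n.-tuple S with its product sigma-algebra), composed with the sample to give
   the random variables M and Z.  Their measurability is meant on S^n: for an
   uncountable F, measurability of the composite on the underlying probability
   space would not exclude behaviour that independence does not control, such as
   coincidences between the X_k when the diagonal of S^2 is not measurable. *)

(* For n > 0, the maximum of the n values; the neutral element -oo does not
   contribute. *)
Definition max_envelope (n : nat) (F : set (S -> R)) (x : n.-tuple S) : \bar R :=
  \big[maxe/-oo]_(k < n) envelope F (tnth x k).

Definition sup_sum (n : nat) (F : set (S -> R)) (x : n.-tuple S) : \bar R :=
  ereal_sup [set ((\sum_(k < n) f (tnth x k))%R)%:E | f in F].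

End defs.

(* Main.v *)
Require Import Defs.
From HB Require Import structures.
From mathcomp Require Import all_boot all_order all_algebra.
From mathcomp Require Import all_classical all_reals all_analysis.
From mathcomp Require Import measurable_realfun.
From mathcomp Require Import ring lra.
Import Order.TTheory GRing.Theory Num.Theory.
Import numFieldNormedType.Exports.
Local Open Scope classical_set_scope.
Local Open Scope ring_scope.

(* With [m = E M], replace the values [f(X_k)] for which [F(X_k) > 8m] by
   [f(s0)], where [F(s0) <= 8m].  This changes [Z] by at most [2 Sum_k Y_k] with
   [Y_k = F(X_k) 1_(F(X_k) > 8m)], and the truncated supremum is still measurable
   because it is [sup_sum F] composed with a measurable map, although other
   natural truncations of [Z] need not be.
   The truncated part is handled by the entropy method.  With [E_k] the
   integral over the k-th coordinate, [E_k Z] replaces the possibly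
   non-measurable leave-one-out supremum [Z_k]: if [b] bounds the means of the
   truncated functions, then [E_k Z >= Z_k - b], and [Var_k Z] controls
   [E_k Z - Z_k] from below, so that
   [Sum_k (Z - E_k Z + excess_k) <= Z + n b].  Combined with the tensorization of
   the entropy this bounds [log E exp(l Z)] in terms of [log E exp(l Z / 2)], and
   iterating the halving replaces the usual differential inequality.
   The sum of the [Y_k] is handled by Chernoff's bound: at most one coordinate is
   typically large, hence [n E h(Y) <= 2 E h(M)] for nondecreasing [h], and
   [expR (l u)] is interpolated between [u] and [u `^ p].  The choice of [l]
   turns the resulting bound into the maximum of the exponential and the
   polynomial terms of the theorem. *)

(** * Bounded measurable functions *)

(** The level 8m comes from Markov's inequality: all coordinates are at most 8m with probability at
    least 7/8, so requiring the others to be small costs only a bounded factor. Substituting a value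
    at a point of S, rather than 0, has a price: the truncated functions have means of order m/n
    instead of 0. This is the parameter b, with n b = 4m, that runs through the concentration
    argument. The square of the polynomial term has the following origin. A single value above t is
    paid for by P(M >= t). Once the values are capped at t, a sum above 6t needs more than six
    nonzero terms, which leaves room for a power higher than the first. If t < 64m, or if the
    exponential or the squared polynomial term exceeds a fixed constant, the claim holds because K
    is large. Otherwise the maximum of these two terms is exp(-4l) with l > e, and this l drives
    Chernoff's bound. *)

Definition bmeas {d} {T : measurableType d} {R : realType} (f : T -> R) :=
  measurable_fun [set: T] f /\ exists M, forall x, `|f x| <= M.

Section bounded_measurable.
Context {d} {T : measurableType d} {R : realType}.
Implicit Types f g : T -> R.

Lemma bmeas_cst (c : R) : bmeas (fun _ : T => c).
Proof. by split; [exact: measurable_cst|exists `|c|]. Qed.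

Lemma bmeasD f g : bmeas f -> bmeas g -> bmeas (fun x => f x + g x).
Proof.
move=> [mf [M fM]] [mg [N gN]]; split; first exact: measurable_funD.
by exists (M + N) => x; rewrite (le_trans (ler_normD _ _))// lerD.
Qed.

Lemma bmeasM f g : bmeas f -> bmeas g -> bmeas (fun x => f x * g x).
Proof.
move=> [mf [M fM]] [mg [N gN]]; split; first exact: measurable_funM.
by exists (M * N) => x; rewrite normrM ler_pM.
Qed.

Lemma bmeasX f k : bmeas f -> bmeas (fun x => f x ^+ k).
Proof.
move=> bf; elim: k => [|k IH]; first by under eq_fun do rewrite expr0; exact: bmeas_cst.
by under eq_fun do rewrite exprS; exact: bmeasM.
Qed.

Lemma bmeasN f : bmeas f -> bmeas (fun x => - f x).
Proof.
move=> [mf [M fM]]; split; first exact: measurableT_comp.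
by exists M => x; rewrite normrN.
Qed.

Lemma bmeasB f g : bmeas f -> bmeas g -> bmeas (fun x => f x - g x).
Proof. by move=> bf bg; apply: bmeasD => //; exact: bmeasN. Qed.

Lemma bmeas_max f g : bmeas f -> bmeas g -> bmeas (fun x => Num.max (f x) (g x)).
Proof.
move=> [mf [M fM]] [mg [N gN]]; split; first exact: measurable_maxr.
exists (M + N) => x; have := fM x; have := gN x.
have := normr_ge0 (f x); have := normr_ge0 (g x).
by case: (leP (f x) (g x)) => _; lra.
Qed.

Lemma bmeas_sum (I : Type) (s : seq I) (h : I -> T -> R) :
  (forall i, bmeas (h i)) -> bmeas (fun x => \sum_(i <- s) h i x).
Proof.
move=> bh; elim: s => [|i s IH].
  by under eq_fun do rewrite big_nil; exact: bmeas_cst.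
by under eq_fun do rewrite big_cons; exact: bmeasD.
Qed.

Lemma bmeas_expR f : bmeas f -> bmeas (fun x => expR (f x)).
Proof.
move=> [mf [M fM]]; split; first exact: measurableT_comp.
exists (expR M) => x; rewrite ger0_norm ?expR_ge0// ler_expR.
exact: le_trans (ler_norm _) (fM x).
Qed.

Lemma bmeas_ln f c : 0 < c -> (forall x, c <= f x) -> bmeas f ->
  bmeas (fun x => ln (f x)).
Proof.
move=> c0 cf [mf [M fM]]; split; first exact: measurableT_comp.
exists (`|ln c| + `|ln M|) => x.
have f0 : 0 < f x by exact: lt_le_trans c0 (cf x).
have fM' : f x <= M by exact: le_trans (ler_norm _) (fM x).
have h1 : ln c <= ln (f x) by rewrite ler_ln ?posrE.
have h2 : ln (f x) <= ln M by rewrite ler_ln ?posrE// (lt_le_trans f0).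
have := ler_norm (ln M); have := ler_norm (- ln c); rewrite normrN.
have := normr_ge0 (ln M); have := normr_ge0 (ln c).
by rewrite ler_norml; lra.
Qed.

Lemma bmeas_comp {d'} {T' : measurableType d'} (h : T' -> T) f :
  measurable_fun [set: T'] h -> bmeas f -> bmeas (fun x => f (h x)).
Proof.
move=> mh [mf [M fM]]; split; first exact: measurableT_comp.
by exists M.
Qed.

End bounded_measurable.

Section bounded_expectation.
Context {d} {T : measurableType d} {R : realType} (P : probability T R).
Implicit Types f g : T -> R.

Lemma bmeas_integrable f : bmeas f -> P.-integrable [set: T] (EFin \o f).
Proof.
move=> [mf [M fM]]; apply: (@le_integrable _ _ _ P _ measurableT _ (EFin \o cst M)) => //.
- exact/measurable_EFinP.
- by move=> x _ /=; rewrite lee_fin (le_trans (fM x))// ler_norm.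
- exact: finite_measure_integrable_cst.
Qed.

Lemma EFin_bmeas f : bmeas f ->
  (\int[P]_x (f x)%:E)%E = (\int[P]_x f x)%:E.
Proof.
by move=> bf; rewrite fineK//; apply: integrable_fin_num => //;
  exact: bmeas_integrable.
Qed.

Lemma bexpD f g : bmeas f -> bmeas g ->
  \int[P]_x (f x + g x) = \int[P]_x f x + \int[P]_x g x.
Proof. by move=> bf bg; rewrite RintegralD//; exact: bmeas_integrable. Qed.

Lemma bexpB f g : bmeas f -> bmeas g ->
  \int[P]_x (f x - g x) = \int[P]_x f x - \int[P]_x g x.
Proof. by move=> bf bg; rewrite RintegralB//; exact: bmeas_integrable. Qed.

Lemma bexpZ c f : bmeas f -> \int[P]_x (c * f x) = c * \int[P]_x f x.
Proof. by move=> bf; rewrite RintegralZl//; exact: bmeas_integrable. Qed.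

Lemma bexpZr c f : bmeas f -> \int[P]_x (f x * c) = \int[P]_x f x * c.
Proof. by move=> bf; rewrite RintegralZr//; exact: bmeas_integrable. Qed.

Lemma bexp_cst c : \int[P]_x c = c.
Proof. by have := Rintegral_cst P measurableT c; rewrite [X in fine X]probability_setT mulr1. Qed.

Lemma bexp_le f g : bmeas f -> bmeas g -> (forall x, f x <= g x) ->
  \int[P]_x f x <= \int[P]_x g x.
Proof.
by move=> bf bg fg; apply: le_Rintegral => //; exact: bmeas_integrable.
Qed.

Lemma bexp_sum (I : Type) (s : seq I) (h : I -> T -> R) :
  (forall i, bmeas (h i)) ->
  \int[P]_x (\sum_(i <- s) h i x) = \sum_(i <- s) \int[P]_x h i x.
Proof.
move=> bh; elim: s => [|i s IH].
  by under eq_Rintegral do rewrite big_nil; rewrite bexp_cst big_nil.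
under eq_Rintegral do rewrite big_cons.
by rewrite bexpD//; [rewrite IH big_cons|exact: bmeas_sum].
Qed.

Lemma bexp_norm_le f M : bmeas f -> (forall x, `|f x| <= M) ->
  `|\int[P]_x f x| <= M.
Proof.
move=> bf fM; rewrite ler_norml; apply/andP; split.
  rewrite -[leLHS]bexp_cst; apply: bexp_le => // [|x]; first exact: bmeas_cst.
  by have := fM x; rewrite ler_norml => /andP[].
rewrite -[leRHS]bexp_cst; apply: bexp_le => // [|x]; first exact: bmeas_cst.
by have := fM x; rewrite ler_norml => /andP[].
Qed.

Lemma bexp_expR_gt0 f : bmeas f -> 0 < \int[P]_x expR (f x).
Proof.
move=> bf; have [_ [M fM]] := bf; apply: (@lt_le_trans _ _ (expR (- M))).
  exact: expR_gt0.
rewrite -[leLHS]bexp_cst; apply: bexp_le => [||x].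
- exact: bmeas_cst.
- exact: bmeas_expR.
- by rewrite ler_expR; have := fM x; rewrite ler_norml => /andP[].
Qed.

(** Jensen's inequality, by integrating the tangent line of [expR] at the mean of [f]. *)
Lemma expR_bexp_le f : bmeas f -> expR (\int[P]_x f x) <= \int[P]_x expR (f x).
Proof.
move=> bf; set c := \int[P]_x f x.
have -> : expR c = \int[P]_x (expR c * (1 + (f x - c))).
  rewrite bexpZ; last first.
    by apply: bmeasD; [exact: bmeas_cst|apply: bmeasB => //; exact: bmeas_cst].
  rewrite bexpD ?bexpB ?bexp_cst -/c ?subrr ?addr0 ?mulr1//;
    try exact: bmeas_cst.
  by apply: bmeasB => //; exact: bmeas_cst.
apply: bexp_le => [||x].
- apply: bmeasM; first exact: bmeas_cst.
  by apply: bmeasD; [exact: bmeas_cst|apply: bmeasB => //; exact: bmeas_cst].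
- exact: bmeas_expR.
- rewrite -[f x in leRHS](subrKC c) expRD ler_pM2l ?expR_gt0//.
  exact: expR_ge1Dx.
Qed.

End bounded_expectation.

Section bounded_fubini.
Context {d1 d2} {T1 : measurableType d1} {T2 : measurableType d2}
  {R : realType} (P1 : probability T1 R) (P2 : probability T2 R).
Variable f : T1 * T2 -> R.
Hypothesis bf : bmeas f.

Lemma bmeas_pair1 x : bmeas (fun y => f (x, y)).
Proof. exact: (bmeas_comp (pair x)). Qed.

Lemma bmeas_pair2 y : bmeas (fun x => f (x, y)).
Proof. exact: (bmeas_comp (pair^~ y)). Qed.

Lemma bmeas_bexp_snd : bmeas (fun x => \int[P2]_y f (x, y)).
Proof.
split; last first.
  have [mf [M fM]] := bf; exists M => x.
  by apply: bexp_norm_le => //; exact: bmeas_pair1.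
have := @measurable_fubini_F _ _ _ _ _ P1 P2 (EFin \o f).
move=> /(_ (bmeas_integrable _ _ bf)) h.
by apply: measurableT_comp h.
Qed.

Lemma bmeas_bexp_fst : bmeas (fun y => \int[P1]_x f (x, y)).
Proof.
split; last first.
  have [mf [M fM]] := bf; exists M => x.
  by apply: bexp_norm_le => //; exact: bmeas_pair2.
have := @measurable_fubini_G _ _ _ _ _ P1 P2 (EFin \o f).
move=> /(_ (bmeas_integrable _ _ bf)) h.
by apply: measurableT_comp h.
Qed.

Lemma bexp_prod : \int[(P1 \x P2)%E]_z f z = \int[P1]_x (\int[P2]_y f (x, y)).
Proof.
rewrite /Rintegral; congr fine.
rewrite -[LHS]integral12_prod_meas1//; last exact: bmeas_integrable.
apply: eq_integral => x _ /=; rewrite fineK//.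
apply: integrable_fin_num => //.
by have := bmeas_integrable P2 _ (bmeas_pair1 x).
Qed.

Lemma bexp_swap :
  \int[P1]_x (\int[P2]_y f (x, y)) = \int[P2]_y (\int[P1]_x f (x, y)).
Proof.
rewrite -bexp_prod /Rintegral; congr fine.
rewrite -[LHS]integral21_prod_meas1//; last exact: bmeas_integrable.
apply: eq_integral => x _ /=; rewrite fineK//.
apply: integrable_fin_num => //.
by have := bmeas_integrable P1 _ (bmeas_pair2 x).
Qed.

End bounded_fubini.

(** * Powers of a probability measure *)

Section tuple_product.
Context {d} {S : measurableType d} {R : realType} (mu : probability S R).

Definition tcons n (p : S * n.-tuple S) : n.+1.-tuple S :=
  [tuple of p.1 :: p.2].

Lemma measurable_tcons n : measurable_fun [set: S * n.-tuple S] (@tcons n).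
Proof. exact: measurable_cons. Qed.

HB.instance Definition _ n := isMeasurableFun.Build _ _ _ _ (@tcons n)
  (@measurable_tcons n).

(** The recursion on the first coordinate turns Fubini's theorem into an induction principle; the
    link with independent samples is made later, on rectangles. *)
Fixpoint tprod n : probability (n.-tuple S) R :=
  match n with
  | 0 => \d_([tuple] : 0.-tuple S)
  | m.+1 => distribution (mu \x tprod m)%E (@tcons m)
  end.

Lemma ge0_integral_tprodS n (f : n.+1.-tuple S -> \bar R) :
  measurable_fun setT f -> (forall x, (0 <= f x)%E) ->
  (\int[tprod n.+1]_x f x =
   \int[mu]_x \int[tprod n]_y f (tcons n (x, y)))%E.
Proof.
move=> mf f0 /=; rewrite ge0_integral_distribution// fubini_tonelli1//.
  by apply: measurableT_comp => //; exact: measurable_tcons.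
by move=> x; exact: f0.
Qed.

Lemma bexp_tprod0 (f : 0.-tuple S -> R) : \int[tprod 0]_x f x = f [tuple].
Proof.
rewrite (_ : f = cst (f [tuple])); first exact: bexp_cst.
by apply/funext => x; rewrite tuple0.
Qed.

Lemma bexp_tprodS n (f : n.+1.-tuple S -> R) : bmeas f ->
  \int[tprod n.+1]_x f x =
  \int[mu]_x (\int[tprod n]_y f (tcons n (x, y))).
Proof.
move=> bf; rewrite -(bexp_prod mu (tprod n) (fun p => f (tcons n p))); last first.
  by apply: bmeas_comp => //; exact: measurable_tcons.
rewrite /Rintegral; congr fine; rewrite [LHS]integral_distribution//.
  by apply/measurable_EFinP; case: bf.
apply: (bmeas_integrable _ (fun p => f (tcons n p))).
by apply: bmeas_comp => //; exact: measurable_tcons.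
Qed.

Definition upd n (x : n.-tuple S) (k : 'I_n) (y : S) : n.-tuple S :=
  [tuple if j == k then y else tnth x j | j < n].

Lemma upd_upd n (x : n.-tuple S) k y z : upd n (upd n x k y) k z = upd n x k z.
Proof. by apply: eq_from_tnth => j; rewrite !tnth_mktuple; case: eqP. Qed.

Lemma upd_id n (x : n.-tuple S) k : upd n x k (tnth x k) = x.
Proof.
by apply: eq_from_tnth => j; rewrite tnth_mktuple; case: eqP => // ->.
Qed.

Lemma upd0 n x (y : n.-tuple S) z :
  upd n.+1 (tcons n (x, y)) ord0 z = tcons n (z, y).
Proof.
apply: eq_from_tnth => j; rewrite tnth_mktuple.
by have [i ->|->//] := unliftP ord0 j; rewrite /= !tnthS.
Qed.

Lemma updS n x (y : n.-tuple S) k z :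
  upd n.+1 (tcons n (x, y)) (lift ord0 k) z = tcons n (x, upd n y k z).
Proof.
apply: eq_from_tnth => j; rewrite tnth_mktuple.
have [i ->|->] := unliftP ord0 j.
  by rewrite !tnthS tnth_mktuple (inj_eq lift_inj).
by rewrite (negbTE (neq_lift _ _)).
Qed.

Lemma measurable_upd n (k : 'I_n) :
  measurable_fun [set: n.-tuple S * S] (fun p => upd n p.1 k p.2).
Proof.
apply/measurable_fun_tnthP => j.
rewrite (_ : _ \o _ = if j == k then snd else (fun p => tnth p.1 j)).
  case: ifP => // _; apply: (@measurableT_comp _ _ _ _ _ _ (fun x => tnth x j)) => //.
  exact: measurable_tnth.
by apply/funext => p /=; rewrite tnth_mktuple; case: ifP.
Qed.

(** Conditional expectation given all coordinates but the k-th, kept as a function of the whole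
    tuple so that it can be subtracted from [f]. *)
Definition int_coord n (k : 'I_n) (f : n.-tuple S -> R) (x : n.-tuple S) : R :=
  \int[mu]_y f (upd n x k y).

Lemma bmeas_updy n (k : 'I_n) (f : n.-tuple S -> R) x : bmeas f ->
  bmeas (fun y => f (upd n x k y)).
Proof.
move=> bf; apply: (bmeas_comp (fun y => upd n x k y)) => //.
by have := measurableT_comp (measurable_upd n k) (pair1_measurable x).
Qed.

Lemma bmeas_upd2 n (k : 'I_n) (f : n.-tuple S -> R) : bmeas f ->
  bmeas (fun p : n.-tuple S * S => f (upd n p.1 k p.2)).
Proof.
by move=> bf; apply: (bmeas_comp _ f (measurable_upd n k)).
Qed.

Lemma bmeas_int_coord n (k : 'I_n) (f : n.-tuple S -> R) : bmeas f -> bmeas (int_coord n k f).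
Proof.
move=> bf; exact: (bmeas_bexp_snd (tprod n) mu _ (bmeas_upd2 _ _ _ bf)).
Qed.

Lemma int_coord_upd n (k : 'I_n) (f : n.-tuple S -> R) x y :
  int_coord n k f (upd n x k y) = int_coord n k f x.
Proof. by apply: eq_Rintegral => z _; rewrite upd_upd. Qed.

Lemma bmeas_tcons n (f : n.+1.-tuple S -> R) x : bmeas f ->
  bmeas (fun y => f (tcons n (x, y))).
Proof.
move=> bf; apply: (bmeas_pair1 (fun p => f (tcons n p))).
by apply: bmeas_comp => //; exact: measurable_tcons.
Qed.

Lemma bmeas_tcons2 n (f : n.+1.-tuple S -> R) : bmeas f ->
  bmeas (fun p => f (tcons n p)).
Proof. by move=> bf; apply: bmeas_comp => //; exact: measurable_tcons. Qed.

(** Tower property. For the first coordinate, Fubini moves the integral over it inside, where the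
    integrand is constant in it; the other coordinates follow by induction on the tail. *)
Lemma bexp_int_coord n (k : 'I_n) (f : n.-tuple S -> R) : bmeas f ->
  \int[tprod n]_x int_coord n k f x = \int[tprod n]_x f x.
Proof.
elim: n k f => [[]//|n IH] k f bf.
rewrite !bexp_tprodS//; last exact: bmeas_int_coord.
have [i ->|->] := unliftP ord0 k; last first.
  rewrite (bexp_swap mu (tprod n) _ (bmeas_tcons2 _ _ bf)).
  rewrite (bexp_swap mu (tprod n) _ (bmeas_tcons2 _ _ (bmeas_int_coord _ _ _ bf))).
  apply: eq_Rintegral => y _.
  under eq_Rintegral do rewrite /int_coord.
  rewrite (_ : (fun x => _) = cst (\int[mu]_x f (tcons n (x, y)))).
    exact: bexp_cst.
  by apply/funext => x /=; apply: eq_Rintegral => z _; rewrite upd0.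
apply: eq_Rintegral => x _.
rewrite -(IH i (fun y => f (tcons n (x, y))))//; last exact: bmeas_tcons.
by apply: eq_Rintegral => y _; apply: eq_Rintegral => z _; rewrite updS.
Qed.

End tuple_product.

(** * Entropy *)

Ltac bm := repeat first
  [ assumption
  | exact: bmeas_cst
  | apply: bmeas_expR
  | apply: bmeasB
  | apply: bmeasD
  | apply: bmeasN
  | apply: bmeasM
  | apply: bmeasX
  | apply: bmeas_max
  | apply: bmeas_sum => ?
  | apply: bmeas_int_coord
  | apply: bmeas_updy ].

Section entropy.
Context {d} {T : measurableType d} {R : realType} (P : probability T R).

(* Jensen turns the variational formula for the entropy of [expR g] into a
   bound that involves [expR g] only through a covariance. *)
Lemma bexp_expR_dual (g h : T -> R) : bmeas g -> bmeas h ->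
  \int[P]_x expR (h x) <= 1 ->
  \int[P]_x (expR (g x) * h x) <=
  \int[P]_x (expR (g x) * (g x - \int[P]_z g z)).
Proof.
move=> bg bh h1.
set L := \int[P]_x expR (g x).
have L0 : 0 < L by exact: bexp_expR_gt0.
have gL : \int[P]_z g z <= ln L.
  by rewrite -ler_expR lnK ?posrE//; exact: expR_bexp_le.
(* Pointwise this is [1 + u <= expR u] at [u = h x - (g x - ln L)], multiplied by [expR (g x)]. *)
have : \int[P]_x (expR (g x) * (h x - (g x - ln L))) <=
       \int[P]_x (L * expR (h x) - expR (g x)).
  apply: bexp_le => [||x]; [by bm|by bm|].
  have := expR_ge1Dx (h x - (g x - ln L)).
  rewrite -(ler_pM2l (expR_gt0 (g x))) => /le_trans-/(_ (expR (h x) * L)).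
  rewrite -[in X in (_ <= X) -> _](lnK L0) -!expRD.
  by rewrite (_ : g x + _ = h x + ln L)//; [|ring]; move=> /(_ (lexx _)); lra.
rewrite bexpB; [|by bm|by bm]; rewrite bexpZ; [|by bm].
rewrite (_ : (fun x => _) = (fun x => expR (g x) * h x -
    (expR (g x) * (g x - \int[P]_z g z) -
      (ln L - \int[P]_z g z) * expR (g x)))); last first.
  by apply/funext => x; ring.
rewrite bexpB; [|by bm|by bm]; rewrite bexpB; [|by bm|by bm].
rewrite bexpZ -/L; [|by bm].
have : L * \int[P]_x expR (h x) <= L * 1 by rewrite ler_pM2l.
have : 0 <= (ln L - \int[P]_z g z) * L by rewrite mulr_ge0 ?subr_ge0// ltW.
lra.
Qed.

End entropy.

Section tensorization.
Context {d} {S : measurableType d} {R : realType} (mu : probability S R).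

(** Tensorization in dual form: for [h = g - ln E (expR g)] the left side is the entropy of
    [expR g]. The freedom in [h] is what carries the induction, since [h] has to be split between
    the first coordinate and the tail. *)
Lemma tprod_expR_dual n (g h : n.-tuple S -> R) : bmeas g -> bmeas h ->
  \int[tprod mu n]_x expR (h x) <= 1 ->
  \int[tprod mu n]_x (expR (g x) * h x) <=
  \sum_(k < n) \int[tprod mu n]_x (expR (g x) * (g x - int_coord mu n k g x)).
Proof.
elim: n g h => [|n IH] g h bg bh.
  rewrite big_ord0 !bexp_tprod0 -expR0 ler_expR => h0.
  by rewrite mulr_ge0_le0// expR_ge0.
rewrite bexp_tprodS; [|by bm] => h1.
have bc (f : n.+1.-tuple S -> R) x : bmeas f -> bmeas (fun y => f (tcons n (x, y))).
  exact: bmeas_tcons.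
have bc2 (f : n.+1.-tuple S -> R) : bmeas f -> bmeas (fun p => f (tcons n p)) by exact: bmeas_tcons2.
have bc1 (f : n.+1.-tuple S -> R) y : bmeas f -> bmeas (fun x => f (tcons n (x, y))).
  by move=> bf; apply: (bmeas_pair2 (fun p => f (tcons n p))); exact: bc2.
(* With this [k], the exponential of [h - k] has integral 1 over the first coordinate for every
   tail, and the exponential of [k] has the same integral as that of [h]; both parts are thus
   admissible test functions. *)
pose k y := ln (\int[mu]_x expR (h (tcons n (x, y)))).
have be : bmeas (fun x => expR (h x)) by bm.
have Ehy y : 0 < \int[mu]_x expR (h (tcons n (x, y))).
  by apply: (bexp_expR_gt0 mu (fun x => h (tcons n (x, y)))); exact: bc1.
have bk : bmeas k.
  have [_ [M hM]] := bh.
  apply: (@bmeas_ln _ _ _ _ (expR (- M))); first exact: expR_gt0.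
    move=> y; rewrite -[leLHS](bexp_cst mu).
    apply: bexp_le => [||x]; [by bm|exact: (bc1 _ y be)|].
    by rewrite ler_expR; have := hM (tcons n (x, y)); rewrite ler_norml => /andP[].
  exact: (bmeas_bexp_fst mu (tprod mu n) _ (bc2 _ be)).
pose tl (x : n.+1.-tuple S) : n.-tuple S := [tuple of behead x].
have tlE x y : tl (tcons n (x, y)) = y by exact/val_inj.
have bkt : bmeas (fun x => k (tl x)).
  by apply: bmeas_comp => //; exact: measurable_behead.
rewrite (_ : (fun x => _) = (fun x => expR (g x) * (h x - k (tl x)) +
  expR (g x) * k (tl x))); last by apply/funext => x; ring.
rewrite bexpD; [|by bm|by bm]; rewrite big_ord_recl; apply: lerD.
- rewrite !bexp_tprodS; [|by bm|by bm].
  rewrite (bexp_swap mu (tprod mu n) (fun p => expR (g (tcons n p)) *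
    (h (tcons n p) - k (tl (tcons n p))))); last first.
    by apply: (bc2 (fun x => expR (g x) * (h x - k (tl x)))); bm.
  rewrite (bexp_swap mu (tprod mu n) (fun p => expR (g (tcons n p)) *
    (g (tcons n p) - int_coord mu n.+1 ord0 g (tcons n p)))); last first.
    by apply: (bc2 (fun x => expR (g x) * (g x - int_coord mu n.+1 ord0 g x))); bm.
  apply: bexp_le => [||y].
  + apply: (bmeas_bexp_fst mu (tprod mu n) _
      (bc2 (fun x => expR (g x) * (h x - k (tl x))) _)); bm.
  + apply: (bmeas_bexp_fst mu (tprod mu n) _
      (bc2 (fun x => expR (g x) * (g x - int_coord mu n.+1 ord0 g x)) _)); bm.
  have := bexp_expR_dual mu (fun x => g (tcons n (x, y)))
    (fun x => h (tcons n (x, y)) - k y) (bc1 _ _ bg).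
  move=> /(_ (bmeasB _ _ (bc1 _ _ bh) (bmeas_cst _))).
  rewrite (_ : (fun x => expR (h _ - _)) =
    (fun x => expR (- k y) * expR (h (tcons n (x, y))))); last first.
    by apply/funext => x; rewrite -expRD addrC.
  rewrite bexpZ; last exact: (bc1 _ y be).
  rewrite expRN /k lnK ?posrE// mulVf ?gt_eqF// => /(_ (lexx _)).
  rewrite -/(k y) => H; apply: le_trans (le_trans H _).
    by rewrite le_eqVlt; apply/orP; left; apply/eqP/eq_Rintegral => x _; rewrite tlE.
  rewrite le_eqVlt; apply/orP; left; apply/eqP/eq_Rintegral => x _.
  by rewrite /int_coord; congr (_ * (_ - _)); apply: eq_Rintegral => z _; rewrite upd0.
- rewrite bexp_tprodS; [|by bm].
  under [leRHS]eq_bigr => i _.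
    rewrite bexp_tprodS; [|by bm]; over.
  rewrite -bexp_sum; last first.
    move=> i; apply: (bmeas_bexp_snd mu (tprod mu n) _
      (bc2 (fun x => expR (g x) * (g x - int_coord mu n.+1 (lift ord0 i) g x)) _)); bm.
  apply: bexp_le => [||x].
  + apply: (bmeas_bexp_snd mu (tprod mu n) _
      (bc2 (fun x => expR (g x) * k (tl x)) _)); bm.
  + apply: bmeas_sum => i; apply: (bmeas_bexp_snd mu (tprod mu n) _
      (bc2 (fun x => expR (g x) * (g x - int_coord mu n.+1 (lift ord0 i) g x)) _)); bm.
  have := IH (fun y => g (tcons n (x, y))) k (bc _ _ bg) bk.
  rewrite (_ : \int[tprod mu n]_y expR (k y) =
      \int[mu]_x (\int[tprod mu n]_y expR (h (tcons n (x, y))))); last first.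
    rewrite (bexp_swap mu (tprod mu n) _ (bc2 _ be)).
    by apply: eq_Rintegral => y _; rewrite lnK ?posrE.
  move=> /(_ h1) H; apply: le_trans (le_trans H _).
    rewrite le_eqVlt; apply/orP; left; apply/eqP/eq_Rintegral => y _.
    by rewrite tlE.
  rewrite le_eqVlt; apply/orP; left; apply/eqP/eq_bigr => i _.
  apply: eq_Rintegral => y _; congr (_ * (_ - _)).
  by rewrite /int_coord; apply: eq_Rintegral => z _; rewrite updS.
Qed.

End tensorization.

(** * Concentration of self-bounded functions *)

Lemma expR_le_inv1B (R : realType) (t : R) : t < 1 -> expR t <= (1 - t)^-1.
Proof.
move=> t1; rewrite -[expR t]invrK -expRN lef_pV2 ?posrE ?expR_gt0 ?subr_gt0//.
exact: expR_ge1Dx.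
Qed.

(** Only an upper bound on [t] is imposed: it is applied to [l] times the deviation of [Z] from its
    conditional mean, which [Zr] controls from above. *)
Lemma expR_mul_bounds (R : realType) (t : R) : t <= 1 / 2 ->
  t <= expR t * t <= t + 2 * t ^+ 2.
Proof.
move=> t12.
have h1 := expR_ge1Dx t.
have h2 := expR_gt0 t.
have [t0|t0] := leP 0 t; last first.
  have e1 : expR t <= 1 by rewrite expR_le1 ltW.
  by apply/andP; split; nra.
have : expR t <= 1 + 2 * t.
  apply: (le_trans (expR_le_inv1B _ _ _)); first lra.
  by rewrite -[leLHS]mul1r ler_pdivrMr; nra.
by move=> h3; apply/andP; split; nra.
Qed.

Lemma expR_le_quad (R : realType) (t : R) : t <= 1 / 2 ->
  expR t <= 1 + t + 2 * t ^+ 2.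
Proof.
move=> t12; apply: (le_trans (expR_le_inv1B _ _ _)); first lra.
rewrite -[leLHS]mul1r ler_pdivrMr; last lra.
have : 0 <= t ^+ 2 * (1 - 2 * t) by rewrite mulr_ge0 ?sqr_ge0//; lra.
by rewrite !expr2; lra.
Qed.

Section self_bounded_concentration.
Context {d} {S : measurableType d} {R : realType} (mu : probability S R).
Variables (n : nat) (Z : n.-tuple S -> R) (r B s2 : R).
Hypotheses (bZ : bmeas Z) (B0 : 0 < B) (s20 : 0 <= s2).

Definition var_coord (k : 'I_n) x := int_coord mu n k (fun y => (Z y - int_coord mu n k Z y) ^+ 2) x.
(* The part of the conditional variance exceeding [s2], the variance of a single
   function; for a supremum it measures how far [E_k Z] lies above [Z_k]. *)
Definition excess (k : 'I_n) x := Num.max 0 ((var_coord k x - s2) / B).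

Hypothesis Zr : forall k x, Z x - int_coord mu n k Z x <= r.
Hypothesis Zself : forall x,
  \sum_(k < n) (Z x - int_coord mu n k Z x + excess k x) <= Z x.

Local Notation "'EE' f" := (\int[tprod mu n]_x f x) (at level 10).
Let G l := \int[tprod mu n]_x expR (l * Z x).
Let A l := \int[tprod mu n]_x (expR (l * Z x) * Z x).
Let V := n%:R * s2.

Let G_gt0 l : 0 < G l.
Proof. by apply: (bexp_expR_gt0 (tprod mu n) (fun x => l * Z x)); bm. Qed.

Let bmeas_var_coord k : bmeas (var_coord k).
Proof. by apply: bmeas_int_coord; bm. Qed.

Let bmeas_excess k : bmeas (excess k).
Proof. by have := bmeas_var_coord k; rewrite /excess => ?; bm. Qed.

(** Conditionally on the other coordinates the deviation [Z - c] has mean 0, so the first-order term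
    of the covariance cancels and a conditional variance remains, at most [s2 + B * excess]. The
    lower bound is used to discard the covariances in [entropy_le]. *)
Let cov_bounds l k : 0 < l -> l * r <= 1 / 2 ->
  0 <= \int[tprod mu n]_x (expR (l * Z x) * (Z x - int_coord mu n k Z x)) <=
  2 * l * \int[tprod mu n]_x (expR (l * Z x) * (s2 + B * excess k x)).
Proof.
move=> l0 lr.
have bw := bmeas_excess k.
rewrite -(bexp_int_coord mu _ k (fun x => expR (l * Z x) * (Z x - int_coord mu n k Z x)));
  [|by bm].
rewrite -(bexp_int_coord mu _ k (fun x => expR (l * Z x) * (s2 + B * excess k x)));
  [|by bm].
rewrite -bexpZ; [|by bm].
suff H x : 0 <= int_coord mu n k (fun x => expR (l * Z x) * (Z x - int_coord mu n k Z x)) x <=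
    2 * l * int_coord mu n k (fun x => expR (l * Z x) * (s2 + B * excess k x)) x.
  apply/andP; split.
    by apply: Rintegral_ge0 => x _; case/andP: (H x).
  by apply: bexp_le => [||x]; [bm|bm|case/andP: (H x)].
set c := int_coord mu n k Z x.
have wE y : excess k (upd n x k y) = excess k x.
  by rewrite /excess /var_coord int_coord_upd.
have bZy := bmeas_updy n k Z x bZ.
have Eu0 : \int[mu]_y (Z (upd n x k y) - c) = 0.
  by rewrite bexpB ?bexp_cst ?subrr//; exact: bmeas_cst.
have -> : int_coord mu n k (fun x => expR (l * Z x) * (Z x - int_coord mu n k Z x)) x =
    expR (l * c) *
    \int[mu]_y (expR (l * (Z (upd n x k y) - c)) * (Z (upd n x k y) - c)).
  rewrite -bexpZ; [|by bm]; apply: eq_Rintegral => y _.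
  by rewrite int_coord_upd -/c mulrA -expRD; congr (expR _ * _); ring.
have -> : int_coord mu n k (fun x => expR (l * Z x) * (s2 + B * excess k x)) x =
    (\int[mu]_y expR (l * Z (upd n x k y))) * (s2 + B * excess k x).
  rewrite -bexpZr; [|by bm]; apply: eq_Rintegral => y _.
  by rewrite wE.
have bounds y : Z (upd n x k y) - c <=
   expR (l * (Z (upd n x k y) - c)) * (Z (upd n x k y) - c) <=
   Z (upd n x k y) - c + 2 * l * (Z (upd n x k y) - c) ^+ 2.
  set u := Z _ - c.
  have ur : u <= r by have := Zr k (upd n x k y); rewrite int_coord_upd.
  have /expR_mul_bounds : l * u <= 1 / 2.
    by apply: le_trans lr; rewrite ler_pM2l.
  rewrite [X in X <= _ <= _]mulrC (_ : _ * (l * u) = expR (l * u) * u * l); last by ring.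
  rewrite (_ : _ + _ = (u + 2 * l * u ^+ 2) * l); last by ring.
  by rewrite !ler_pM2r.
have vE : \int[mu]_y (Z (upd n x k y) - c + 2 * l * (Z (upd n x k y) - c) ^+ 2)
    = 2 * l * var_coord k x.
  have -> : var_coord k x = \int[mu]_y ((Z (upd n x k y) - c) ^+ 2).
    by apply: eq_Rintegral => y _; rewrite int_coord_upd.
  by rewrite bexpD ?Eu0 ?add0r ?bexpZ//; bm.
apply/andP; split.
  rewrite mulr_ge0 ?expR_ge0// -[leLHS]Eu0.
  by apply: bexp_le => [||y]; [bm|bm|case/andP: (bounds y)].
apply: (@le_trans _ _ (expR (l * c) * (2 * l * var_coord k x))).
  rewrite ler_pM2l ?expR_gt0// -vE.
  by apply: bexp_le => [||y]; [bm|bm|case/andP: (bounds y)].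
rewrite mulrCA; apply: ler_wpM2l; first by rewrite mulr_ge0// ltW.
apply: (@le_trans _ _ (expR (l * c) * (s2 + B * excess k x))).
  rewrite ler_pM2l ?expR_gt0// -lerBlDl [B * _]mulrC -ler_pdivrMr//.
  by rewrite /excess le_max lexx orbT.
apply: ler_wpM2r.
  by rewrite addr_ge0// mulr_ge0//; [exact: ltW|rewrite /excess le_max lexx].
(* Jensen in the k-th coordinate replaces the exponential of the conditional mean by the conditional
   mean of the exponential. *)
have := expR_bexp_le mu (fun y => l * Z (upd n x k y)).
by rewrite bexpZ//; apply; bm.
Qed.

(** Self-boundedness weighted by [expR (l * Z)] gives [C + W <= A l]. Since [C >= 0], the total
    excess [W] is at most [A l], and the covariance bound becomes free of it. *)
Let entropy_le l : 0 < l -> l * r <= 1 / 2 ->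
  l * A l - G l * ln (G l) <= 2 * l ^+ 2 * (V * G l + B * A l).
Proof.
move=> l0 lr.
have bw := bmeas_excess.
set C := \sum_(k < n) \int[tprod mu n]_x (expR (l * Z x) * (Z x - int_coord mu n k Z x)).
set W := \sum_(k < n) \int[tprod mu n]_x (expR (l * Z x) * excess k x).
have CW : C + W <= A l.
  rewrite -big_split /=.
  have E k : \int[tprod mu n]_x (expR (l * Z x) * (Z x - int_coord mu n k Z x)) +
      \int[tprod mu n]_x (expR (l * Z x) * excess k x) =
      \int[tprod mu n]_x (expR (l * Z x) * (Z x - int_coord mu n k Z x + excess k x)).
    have := bw k => bwk; rewrite -bexpD; [|by bm|by bm].
    by apply: eq_Rintegral => x _; ring.
  rewrite (eq_bigr _ (fun k _ => E k)) -bexp_sum; last first.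
    by move=> k; have := bw k => bwk; bm.
  apply: bexp_le => [||x]; [by apply: bmeas_sum => k; have := bw k => bwk; bm|by bm|].
  by rewrite -mulr_sumr ler_pM2l ?expR_gt0.
have C0 : 0 <= C.
  by apply: sumr_ge0 => k _; case/andP: (cov_bounds l k l0 lr).
have CV : C <= 2 * l * (V * G l + B * W).
  apply: (@le_trans _ _ (\sum_(k < n) (2 * l *
      \int[tprod mu n]_x (expR (l * Z x) * (s2 + B * excess k x))))).
    by apply: ler_sum => k _; case/andP: (cov_bounds l k l0 lr).
  rewrite -mulr_sumr le_eqVlt; apply/orP; left; apply/eqP; congr (_ * _).
  have E k : \int[tprod mu n]_x (expR (l * Z x) * (s2 + B * excess k x)) =
     s2 * G l + B * \int[tprod mu n]_x (expR (l * Z x) * excess k x).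
    have := bw k => bwk; rewrite -!bexpZ; [|by bm|by bm].
    rewrite -bexpD; [|by bm|by bm].
    by apply: eq_Rintegral => x _; ring.
  rewrite (eq_bigr _ (fun k _ => E k)) big_split /= sumr_const card_ord -mulr_sumr.
  by rewrite -mulr_natl /V; congr (_ + _); rewrite mulrA.
have ent : l * A l - G l * ln (G l) <= l * C.
  have := tprod_expR_dual mu n (fun x => l * Z x) (fun x => l * Z x - ln (G l)).
  have bl : bmeas (fun x => l * Z x) by bm.
  have bl' : bmeas (fun x => l * Z x - ln (G l)) by bm.
  move=> /(_ bl bl').
  rewrite (_ : (fun x => expR (_ - _)) = fun x => expR (l * Z x) * (G l)^-1); last first.
    by apply/funext => x; rewrite expRD expRN lnK// posrE.
  rewrite bexpZr; [|by bm]; rewrite -/(G l) mulfV ?gt_eqF// => /(_ (lexx _)).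
  rewrite (_ : (fun x => _ * (_ - ln _)) = (fun x => l * (expR (l * Z x) * Z x) -
     ln (G l) * expR (l * Z x))); last by apply/funext => x; ring.
  rewrite bexpB; [|by bm|by bm]; rewrite !bexpZ; [|by bm|by bm].
  rewrite -/(A l) -/(G l) [ln _ * _]mulrC => /le_trans; apply.
  rewrite /C mulr_sumr ler_sum// => k _; rewrite -bexpZ; [|by bm].
  rewrite le_eqVlt; apply/orP; left; apply/eqP; apply: eq_Rintegral => x _.
  have -> : int_coord mu n k (fun x => l * Z x) x = l * int_coord mu n k Z x.
    by rewrite /int_coord bexpZ//; bm.
  by ring.
apply: (le_trans ent).
have l2 : 0 <= 2 * l ^+ 2 by rewrite mulr_ge0 ?sqr_ge0.
have : l * C <= l * (2 * l * (V * G l + B * W)) by rewrite ler_pM2l.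
move=> /le_trans; apply; rewrite (_ : l * _ = 2 * l ^+ 2 * (V * G l + B * W)); last by ring.
by rewrite ler_wpM2l// lerD2l ler_pM2l//; lra.
Qed.

(** Jensen's inequality under the law with density [expR (l * Z) / G l]: [a] is the mean of
    [l / 2 * Z] there, and [G (l / 2) / G l] is the mean of [expR (- (l / 2 * Z))]. *)
Let G_half l : 0 < l -> expR (- (l * A l / (2 * G l))) * G l <= G (l / 2).
Proof.
move=> l0; set a := _ / _.
have aG : a * G l = l / 2 * A l.
  by rewrite /a; field; rewrite gt_eqF.
have : \int[tprod mu n]_x (expR (- a) * (expR (l * Z x) * (1 + a - l / 2 * Z x)))
   <= G (l / 2).
  apply: bexp_le => [||x]; [by bm|by bm|].
  have -> : expR (l / 2 * Z x) = expR (- a) * (expR (l * Z x) * expR (a - l / 2 * Z x)).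
    by rewrite -!expRD; congr expR; field.
  rewrite ler_pM2l ?expR_gt0// ler_pM2l ?expR_gt0// -addrA.
  exact: expR_ge1Dx.
rewrite bexpZ; [|by bm].
rewrite (_ : (fun x => _ * (1 + a - _)) = (fun x => (1 + a) * expR (l * Z x) -
  l / 2 * (expR (l * Z x) * Z x))); last by apply/funext => x; field.
rewrite bexpB; [|by bm|by bm]; rewrite !bexpZ; [|by bm|by bm].
by rewrite -/(G l) -/(A l) mulrDl mul1r aG addrK.
Qed.

Let h l := ln (G l) / l.

(** Eliminates the tilted mean [H'] between the entropy bound and [G_half]. The factor of
    [h (l / 2)] is the factor of [h l] with [l] halved, so the steps chain without loss. *)
Let h_step l : 0 < l -> l * r <= 1 / 2 -> 2 * B * l <= 1 ->
  (1 - 4 * B * l) * h l <= (1 - 2 * B * l) * h (l / 2) + 2 * V * l.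
Proof.
move=> l0 lr Bl.
have Gl0 := G_gt0 l.
set H' := A l / G l.
have e1 : H' * (1 - 2 * B * l) <= h l + 2 * V * l.
  rewrite -(ler_pM2l l0) -(ler_pM2r Gl0) /H' /h.
  have := entropy_le l l0 lr.
  have -> : l * (ln (G l) / l + 2 * V * l) * G l =
    G l * ln (G l) + 2 * l ^+ 2 * (V * G l) by field; rewrite gt_eqF.
  have -> : l * (A l / G l * (1 - 2 * B * l)) * G l =
    l * A l - 2 * l ^+ 2 * (B * A l) by field; rewrite gt_eqF.
  by lra.
have e2 : 2 * h l - H' <= h (l / 2).
  have l20 : 0 < l / 2 by rewrite divr_gt0.
  rewrite -(ler_pM2r l20) /h divfK ?gt_eqF//.
  have := G_half l l0; rewrite -ler_ln ?posrE ?mulr_gt0 ?expR_gt0//.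
  rewrite lnM ?posrE ?expR_gt0// expRK.
  have -> : (2 * (ln (G l) / l) - H') * (l / 2) =
    - (l * A l / (2 * G l)) + ln (G l).
    by rewrite /H'; field; rewrite !gt_eqF.
  by [].
have : (1 - 2 * B * l) * (2 * h l - H') <= (1 - 2 * B * l) * h (l / 2).
  by rewrite ler_wpM2l// subr_ge0.
by lra.
Qed.

(** The errors [2 * V * l / 2 ^+ j] form a geometric series with sum [4 * V * (l - l / 2 ^+ J)]. *)
Let h_iter l J : 0 < l -> l * r <= 1 / 2 -> 4 * B * l <= 1 ->
  (1 - 4 * B * l) * h l <= (1 - 4 * B * (l / 2 ^+ J)) * h (l / 2 ^+ J) +
    4 * V * l.
Proof.
move=> l0 lr Bl.
have V0 : 0 <= V by rewrite mulr_ge0.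
suff : (1 - 4 * B * l) * h l <= (1 - 4 * B * (l / 2 ^+ J)) * h (l / 2 ^+ J) +
    4 * V * (l - l / 2 ^+ J).
  move=> /le_trans; apply; rewrite lerD2l ler_wpM2l// ?mulr_ge0// lerBlDr lerDl.
  by rewrite divr_ge0 ?exprn_ge0// ltW.
elim: J => [|J IH]; first by rewrite expr0 divr1 subrr mulr0 addr0.
apply: (le_trans IH).
set l' := l / 2 ^+ J.
have -> : l / 2 ^+ J.+1 = l' / 2 by rewrite /l' exprSr invfM mulrA.
have p0 : 0 < (2 : R) ^+ J by rewrite exprn_gt0.
have l'0 : 0 < l' by rewrite divr_gt0.
have l'l : l' <= l.
  by rewrite ler_pdivrMr// ler_peMr ?(ltW l0)// exprn_ege1// ler1n.
have l'r : l' * r <= 1 / 2.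
  have [r0|r0] := leP 0 r; first by apply: le_trans lr; rewrite ler_wpM2r.
  by apply: (@le_trans _ _ 0); rewrite ?mulr_ge0_le0 ?ltW// divr_gt0.
have BB : B * l' <= B * l by rewrite ler_pM2l.
have := h_step l' l'0 l'r.
have -> : 4 * B * (l' / 2) = 2 * B * l' by field.
have := mulr_gt0 B0 l'0.
move=> ? /(_ ltac:(lra)).
have -> : 4 * V * (l - l' / 2) = 4 * V * (l - l') + 2 * V * l' by field.
lra.
Qed.

Let EZ := \int[tprod mu n]_x Z x.

(** Limit of [h_iter] as [J] grows, since [h m] tends to the mean of [Z] when [m] tends to 0;
    [small] is the quantitative form of this convergence. *)
Lemma ln_mgf_le l : 0 < l -> l * r <= 1 / 2 -> 4 * B * l <= 1 ->
  (1 - 4 * B * l) * (ln (\int[tprod mu n]_x expR (l * Z x)) / l) <=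
  EZ + 4 * V * l.
Proof.
move=> l0 lr Bl; rewrite -/(G l) -/(h l).
have [_ [M0 ZM0]] := bZ.
pose M := `|M0| + 1.
have M1 : 1 <= M by rewrite lerDr.
have ZM x : `|Z x| <= M.
  by apply: (le_trans (ZM0 x)); have := ler_norm M0; rewrite /M; lra.
have EZM : `|EZ| <= M by exact: bexp_norm_le.
have small m : 0 < m -> m * M <= 1 / 2 -> h m <= EZ + 2 * m * M ^+ 2.
  move=> m0 mM; rewrite /h ler_pdivrMr//.
  apply: (@le_trans _ _ (G m - 1)).
    have := @le_ln1Dx _ (G m - 1); rewrite subrKC; apply.
    by have := G_gt0 m; lra.
  rewrite lerBlDr.
  apply: (@le_trans _ _ (\int[tprod mu n]_x (m * Z x + (1 + 2 * (m * M) ^+ 2)))).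
    apply: bexp_le => [||x]; [by bm|by bm|].
    have Zx := ZM x.
    have mZ : m * Z x <= 1 / 2.
      apply: le_trans mM; rewrite ler_pM2l//.
      exact: le_trans (ler_norm _) (ZM x).
    apply: (le_trans (expR_le_quad _ _ mZ)).
    have : (m * Z x) ^+ 2 <= (m * M) ^+ 2.
      rewrite !exprMn ler_wpM2l ?sqr_ge0// -[Z x ^+ 2]real_normK ?num_real//.
      by rewrite ler_pXn2r ?nnegrE ?normr_ge0//; lra.
    lra.
  rewrite bexpD; [|by bm|by bm]; rewrite bexpZ// bexp_cst -/EZ.
  rewrite exprMn; set M2 := M ^+ 2; rewrite le_eqVlt; apply/orP; left.
  by apply/eqP; ring.
apply/ler_addgt0Pr => e e0.
(* At [m = l / q], [K / q] collects the error from the factor [1 - 4 * B * m], the error from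
   [small], and the term [2 * m * M] that enforces [m * M <= 1 / 2]. *)
pose K := 4 * B * l * M + 2 * l * M ^+ 2 + 2 * l * M.
have K0 : 0 < K.
  rewrite /K; have := mulr_gt0 B0 l0; have := sqr_ge0 M.
  have M0' : 0 < M by lra.
  have := mulr_gt0 l0 M0'; have := mulr_gt0 (mulr_gt0 B0 l0) M0'.
  have := mulr_ge0 (ltW l0) (sqr_ge0 M).
  lra.
have [J HJ] : exists J, K / Num.min e 1 <= 2 ^+ J.
  have e10 : 0 < Num.min e 1 by rewrite lt_min e0 ltr01.
  exists (Num.bound (K / Num.min e 1)).
  have := archi_boundP (ltW (divr_gt0 K0 e10)).
  move=> /ltW /le_trans; apply.
  by rewrite -natrX ler_nat ltnW// ltn_expl.
set q := 2 ^+ J in HJ.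
have q0 : 0 < q by rewrite exprn_gt0.
have e10 : 0 < Num.min e 1 by rewrite lt_min e0 ltr01.
have Kq : K / q <= Num.min e 1.
  by rewrite ler_pdivrMr// mulrC -ler_pdivrMr.
have Kqe : K / q <= e by apply: le_trans Kq _; rewrite ge_min lexx.
have Kq1 : K / q <= 1 by apply: le_trans Kq _; rewrite ge_min lexx orbT.
set m := l / q.
have m0 : 0 < m by rewrite divr_gt0.
have KqE : K / q = 4 * B * m * M + 2 * m * M ^+ 2 + 2 * m * M.
  by rewrite /K /m; field; rewrite gt_eqF.
have Bm : 0 < B * m by rewrite mulr_gt0.
have mM0 : 0 < m * M by rewrite mulr_gt0//; lra.
have BmM : 0 < B * m * M by rewrite mulr_gt0//; lra.
have mM2 : 0 <= m * M ^+ 2 by rewrite mulr_ge0 ?sqr_ge0// ltW.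
have mM : m * M <= 1 / 2 by move: Kq1; rewrite KqE; lra.
have hm := small m m0 mM.
apply: (le_trans (h_iter l J l0 lr Bl)); rewrite -/q -/m.
have c0 : 0 <= 1 - 4 * B * m.
  have : B * m * 1 <= B * m * M by rewrite ler_pM2l.
  by move: Kq1; rewrite KqE; lra.
have : (1 - 4 * B * m) * h m <= (1 - 4 * B * m) * (EZ + 2 * m * M ^+ 2).
  by rewrite ler_wpM2l.
have : - M <= EZ by move: EZM; rewrite ler_norml => /andP[].
rewrite -(ler_pM2l Bm).
have : 0 <= B * m * (m * M ^+ 2) by rewrite mulr_ge0// ltW.
move: Kqe; rewrite KqE.
lra.
Qed.

(** The factor 2 before the mean is the price of dividing by [1 - 4 * B * l], which is at least 1/2
    here. *)
Lemma self_bounded_tail l s : 0 < l -> l * r <= 1 / 2 -> 8 * B * l <= 1 ->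
  0 <= EZ ->
  (tprod mu n [set x | (2 * EZ + s < Z x)%R] <=
   (expR (- (l * s) + 8 * V * l ^+ 2))%:E)%E.
Proof.
move=> l0 lr Bl EZ0.
have V0 : 0 <= V by rewrite mulr_ge0.
have Bl0 := mulr_gt0 B0 l0.
have hl : h l <= 2 * EZ + 8 * V * l.
  (* Bounding [1 - 4 * B * l] below by 1/2 in front of [h l] requires [h l] to be nonnegative. *)
  have [h0|h0] := leP (h l) 0.
    apply: (le_trans h0); have := mulr_ge0 V0 (ltW l0); lra.
  have := ln_mgf_le l l0 lr ltac:(lra); rewrite -/(G l) -/(h l).
  have : (1 / 2) * h l <= (1 - 4 * B * l) * h l by rewrite ler_pM2r//; lra.
  lra.
have GE : G l <= expR (l * (2 * EZ + 8 * V * l)).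
  rewrite -[G l]lnK ?posrE// ler_expR mulrC -ler_pdivrMr//.
have mA : measurable [set x | 2 * EZ + s < Z x].
  have /measurable_EFinP mZ := bZ.1.
  have := emeasurable_fun_o_infty measurableT mZ (2 * EZ + s)%:E.
  by rewrite setTI (_ : [set x | _] = [set x | 2 * EZ + s < Z x]).
apply: (@le_trans _ _ ((expR (- (l * (2 * EZ + s))) * G l)%:E)); last first.
  rewrite lee_fin (_ : - _ + _ = - (l * (2 * EZ + s)) + l * (2 * EZ + 8 * V * l)).
    by rewrite expRD ler_pM2l ?expR_gt0.
  by ring.
rewrite -[_ * G l]bexpZ; [|by bm]; rewrite -EFin_bmeas; [|by bm].
rewrite -[X in (tprod mu n X <= _)%E]setIT -integral_indic//.
apply: ge0_le_integral => //.
- exact/measurable_EFinP/measurable_indic.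
- apply/measurable_EFinP.
  by have [] : bmeas (fun x => expR (- (l * (2 * EZ + s))) * expR (l * Z x)) by bm.
- move=> x _; rewrite lee_fin indicE; case: (boolP (x \in _)) => [|_]; last first.
    by rewrite mulr_ge0 ?expR_ge0.
  rewrite inE /= => xA; rewrite -expRD -[leLHS]expR0 ler_expR addrC subr_ge0.
  by rewrite ler_pM2l// ltW.
Qed.

End self_bounded_concentration.

(** * Suprema over a uniformly bounded class *)

Lemma bexp_tnth {d} {S : measurableType d} {R : realType} (mu : probability S R)
    (n : nat) (k : 'I_n) (g : S -> R) : bmeas g ->
  \int[tprod mu n]_x g (tnth x k) = \int[mu]_y g y.
Proof.
move=> bg.
have bgk : bmeas (fun x : n.-tuple S => g (tnth x k)).
  by apply: (bmeas_comp (fun x => tnth x k)) => //; exact: measurable_tnth.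
rewrite -(bexp_int_coord mu n k)// -[RHS](bexp_cst (tprod mu n)).
apply: eq_Rintegral => x _; apply: eq_Rintegral => y _.
by rewrite tnth_mktuple eqxx.
Qed.

Section bounded_class.
Context {d} {S : measurableType d} {R : realType} (mu : probability S R).
Variables (n : nat) (G : set (S -> R)) (rho b s2 : R).
Hypotheses (G0 : G !=set0) (b0 : 0 <= b) (rb0 : 0 < rho + b) (s20 : 0 <= s2).
Hypothesis mG : forall g, G g -> measurable_fun [set: S] g.
Hypothesis G_rho : forall g x, G g -> `|g x| <= rho.
Hypothesis G_b : forall g, G g -> `|\int[mu]_x g x| <= b.
Hypothesis G_s2 : forall g, G g -> \int[mu]_x (g x ^+ 2) <= s2.

Let sumg (x : n.-tuple S) (g : S -> R) := \sum_(k < n) g (tnth x k).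
Let sumg' (x : n.-tuple S) k (g : S -> R) := \sum_(j < n | j != k) g (tnth x j).

Definition real_sup_sum (x : n.-tuple S) := sup (sumg x @` G).

Hypothesis mT : measurable_fun [set: n.-tuple S] real_sup_sum.

Let bG g : G g -> bmeas g.
Proof. by move=> Gg; split; [exact: mG|exists rho => x; exact: G_rho]. Qed.

Let sumgE x k g : sumg x g = g (tnth x k) + sumg' x k g.
Proof. by rewrite /sumg (bigD1 k). Qed.

Let sumg_upd x k y g : sumg (upd n x k y) g = g y + sumg' x k g.
Proof.
rewrite (sumgE _ k) tnth_mktuple eqxx; congr (_ + _).
by apply: eq_bigr => j /negbTE jk; rewrite tnth_mktuple jk.
Qed.

Let sumg_le x g : G g -> `|sumg x g| <= n%:R * rho.
Proof.
move=> Gg; apply: (le_trans (ler_norm_sum _ _ _)).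
rewrite mulr_natl -[n in leRHS]card_ord -sumr_const.
by apply: ler_sum => k _; exact: G_rho.
Qed.

Let sumg'_ub x k g : G g -> sumg' x k g <= (n.+1)%:R * rho.
Proof.
move=> Gg; have := sumg_le x g Gg; rewrite (sumgE _ k).
have := G_rho g (tnth x k) Gg; rewrite !ler_norml mulrSr => /andP[+ _] /andP[_].
lra.
Qed.

Let has_sup_sumg x : has_sup (sumg x @` G).
Proof.
split; first by have [g Gg] := G0; exists (sumg x g); exists g.
exists (n%:R * rho) => _ [g Gg <-]; exact: le_trans (ler_norm _) (sumg_le x g Gg).
Qed.

Let has_sup_sumg' x k : has_sup (sumg' x k @` G).
Proof.
split; first by have [g Gg] := G0; exists (sumg' x k g); exists g.
by exists (n.+1%:R * rho) => _ [g Gg <-]; exact: sumg'_ub.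
Qed.

Let le_T x g : G g -> sumg x g <= real_sup_sum x.
Proof. by move=> Gg; apply: ub_le_sup; [exact: (has_sup_sumg x).2|exists g]. Qed.

Let T_le x M : (forall g, G g -> sumg x g <= M) -> real_sup_sum x <= M.
Proof.
move=> H; apply: ge_sup; first exact: (has_sup_sumg x).1.
by move=> _ [g Gg <-]; exact: H.
Qed.

Let bT : bmeas real_sup_sum.
Proof.
split => //; exists (n%:R * rho) => x; rewrite ler_norml; apply/andP; split.
  have [g Gg] := G0; apply: le_trans (le_T x g Gg).
  by have := sumg_le x g Gg; rewrite ler_norml => /andP[].
apply: T_le => g Gg; exact: le_trans (ler_norm _) (sumg_le x g Gg).
Qed.

Let Z' x k := sup (sumg' x k @` G).

Let le_Z' x k g : G g -> sumg' x k g <= Z' x k.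
Proof. by move=> Gg; apply: ub_le_sup; [exact: (has_sup_sumg' x k).2|exists g]. Qed.

Let T_upd_le x k y : real_sup_sum (upd n x k y) <= Z' x k + rho.
Proof.
apply: T_le => g Gg; rewrite sumg_upd addrC lerD ?le_Z'//.
exact: le_trans (ler_norm _) (G_rho g y Gg).
Qed.

Let cT k x := int_coord mu n k real_sup_sum x.

Let cT_ge k x g : G g -> \int[mu]_y g y + sumg' x k g <= cT k x.
Proof.
move=> Gg; have bg := bG g Gg.
rewrite -[X in _ + X](bexp_cst mu) -bexpD; [|by bm|by bm].
by apply: bexp_le => [||y]; [bm|bm|rewrite -sumg_upd le_T].
Qed.

Let cT_le k x : cT k x <= Z' x k + rho.
Proof.
rewrite -[leRHS](bexp_cst mu); apply: bexp_le => [||y]; [by bm|by bm|].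
exact: T_upd_le.
Qed.

Let Z'_le k x : Z' x k - b <= cT k x.
Proof.
rewrite lerBlDr; apply: ge_sup; first exact: (has_sup_sumg' x k).1.
move=> _ [g Gg <-]; have := cT_ge k x g Gg.
have := G_b g Gg; rewrite ler_norml => /andP[].
lra.
Qed.

Let T_le_Z' k x : real_sup_sum x <= Z' x k + rho.
Proof. by rewrite -{1}(upd_id n x k) T_upd_le. Qed.

Let V k x := \int[mu]_y ((real_sup_sum (upd n x k y) - cT k x) ^+ 2).

(** Compares the supremum with a single near maximizer [g] of the sum without the k-th coordinate.
    The variance of [g] is at most [s2]; what remains is of first order in [dl], the gap between [c]
    and the mean of [g] plus [a]. *)
Let V_le k x : V k x - s2 <= 4 * (rho + b) * (cT k x - Z' x k + b).
Proof.
set r := rho + b.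
apply/ler_addgt0Pr => e e0.
(* The bound by [r] yields [dl <= 2 * r], so that [dl ^+ 2] is at most linear in [dl]; the other one
   keeps the final error below [e]. *)
pose e' := Num.min r (e / (4 * r)).
have r4 : 0 < 4 * r by rewrite mulr_gt0.
have e'0 : 0 < e' by rewrite lt_min rb0 divr_gt0.
have e'r : e' <= r by rewrite ge_min lexx.
have e'e : 4 * r * e' <= e.
  by rewrite mulrC -ler_pdivlMr// ge_min lexx orbT.
have [_ [g Gg <-] gZ'] := sup_adherent e'0 (has_sup_sumg' x k).
have bg := bG g Gg.
set a := sumg' x k g in gZ'.
set c := cT k x.
set Eg := \int[mu]_y g y.
pose dl := c - a - Eg.
have dl0 : 0 <= dl by have := cT_ge k x g Gg; rewrite /dl -/c -/a -/Eg; lra.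
have Egb : - b <= Eg by have := G_b g Gg; rewrite ler_norml => /andP[].
have Egb' : Eg <= b by have := G_b g Gg; rewrite ler_norml => /andP[].
have cZ := cT_le k x.
have cZ' := Z'_le k x.
have dl1 : dl <= c - Z' x k + b + e' by rewrite /dl; move: gZ'; rewrite /Z'; lra.
have dl2 : dl <= 2 * r by move: cZ; rewrite -/c; rewrite /r in e'r *; lra.
have bTy := bmeas_updy n k real_sup_sum x bT.
have Vdl : V k x <= s2 + dl ^+ 2 + 2 * r * dl.
  have Tg y : g y + a <= real_sup_sum (upd n x k y).
    by rewrite -sumg_upd le_T.
  have : V k x <= \int[mu]_y (g y ^+ 2 + (2 * (a - c) * g y + (a - c) ^+ 2) +
      2 * r * (real_sup_sum (upd n x k y) - (g y + a))).
    apply: bexp_le => [||y]; [by bm|by bm|].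
    have := Tg y; have := T_upd_le x k y; set t := real_sup_sum _ => tZ gt.
    have grho : g y <= rho by exact: le_trans (ler_norm _) (G_rho g y Gg).
    have aZ : a <= Z' x k by exact: le_Z'.
    (* Difference of squares: [(t - c) ^+ 2 - (g y + a - c) ^+ 2] has the factor
       [(t - c) + (g y + a - c)], and each of these two summands is at most [r]. *)
    have : 0 <= (t - (g y + a)) * (2 * r - ((t - c) + (g y + a - c))).
      by rewrite mulr_ge0 ?subr_ge0// /r; move: cZ'; rewrite -/c; lra.
    move=> H; rewrite -subr_ge0; apply: (le_trans H).
    by rewrite -/c le_eqVlt; apply/orP; left; apply/eqP; ring.
  rewrite bexpD; [|by bm|by bm]; rewrite bexpD; [|by bm|by bm].
  rewrite bexpD; [|by bm|by bm]; rewrite !bexpZ; try by bm.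
  rewrite bexpB; [|by bm|by bm]; rewrite bexpD; [|by bm|by bm].
  rewrite !bexp_cst -/Eg -[\int[mu]_y real_sup_sum _]/c.
  have := G_s2 g Gg.
  have -> : dl ^+ 2 = Eg ^+ 2 + 2 * (a - c) * Eg + (a - c) ^+ 2.
    by rewrite /dl; ring.
  have -> : c - (Eg + a) = dl by rewrite /dl; ring.
  have := sqr_ge0 Eg.
  lra.
have : dl * dl <= 2 * r * dl by rewrite ler_wpM2r.
have : 4 * r * dl <= 4 * r * (c - Z' x k + b + e') by rewrite ler_pM2l.
rewrite expr2 in Vdl; rewrite -/c; lra.
Qed.

(** For a near maximizer [g] of the full sum, dropping the k-th coordinate lowers the supremum by at
    most [g (tnth x k) + e'], and these amounts add up to the value of [g]. *)
Let sum_T_Z' x : \sum_(k < n) (real_sup_sum x - Z' x k) <= real_sup_sum x.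
Proof.
apply/ler_addgt0Pr => e e0.
pose e' := e / n.+1%:R.
have e'0 : 0 < e' by rewrite divr_gt0// ltr0n.
have [_ [g Gg <-] gT] := sup_adherent e'0 (has_sup_sumg x).
apply: (@le_trans _ _ (\sum_(k < n) (g (tnth x k) + e'))).
  apply: ler_sum => k _; have := le_Z' x k g Gg; move: gT.
  by rewrite -/(real_sup_sum x) (sumgE x k); lra.
rewrite big_split /= sumr_const card_ord -mulr_natl.
apply: lerD; first exact: le_T.
by rewrite /e' mulrCA ler_piMr ?(ltW e0)// ler_pdivrMr ?ltr0n// mul1r ler_nat.
Qed.

Let ET := \int[tprod mu n]_x real_sup_sum x.

Lemma bexp_real_sup_sum_ge : - (n%:R * b) <= ET.
Proof.
have [g Gg] := G0; have bg := bG g Gg.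
have bgk k : bmeas (fun x : n.-tuple S => g (tnth x k)).
  by apply: (bmeas_comp (fun x => tnth x k)) => //; exact: measurable_tnth.
apply: (@le_trans _ _ (\int[tprod mu n]_x sumg x g)); last first.
  apply: bexp_le => // [|x]; last exact: le_T.
  exact: bmeas_sum.
rewrite bexp_sum// mulr_natl -[n in _ *+ n]card_ord -sumr_const -sumrN.
apply: ler_sum => k _; rewrite bexp_tnth//.
by have := G_b g Gg; rewrite ler_norml => /andP[].
Qed.

Lemma real_sup_sum_tail l s : 0 < l -> 32 * (rho + b) * l <= 1 ->
  (tprod mu n [set x | (2 * (ET + n%:R * b) + s < real_sup_sum x)%R] <=
   (expR (- (l * s) + 8 * (n%:R * s2) * l ^+ 2))%:E)%E.
Proof.
move=> l0 lr.
(* The shift absorbs the [n] errors [b] from [Z'_le] in the self-bounding condition, and it makes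
   the mean nonnegative. *)
pose Z x := real_sup_sum x + n%:R * b.
have bZ : bmeas Z by rewrite /Z; bm.
have EZ : \int[tprod mu n]_x Z x = ET + n%:R * b.
  by rewrite bexpD ?bexp_cst//; bm.
have cZ k x : int_coord mu n k Z x = cT k x + n%:R * b.
  have bTy := bmeas_updy n k real_sup_sum x bT.
  by rewrite /int_coord bexpD ?bexp_cst//; bm.
have VE k x : var_coord mu n Z k x = V k x.
  apply: eq_Rintegral => y _; rewrite int_coord_upd cZ /Z; congr (_ ^+ 2); ring.
have r4 : 0 < 4 * (rho + b) by rewrite mulr_gt0.
have lr0 : 0 < (rho + b) * l by rewrite mulr_gt0.
have Zr k x : Z x - int_coord mu n k Z x <= rho + b.
  by rewrite cZ /Z; have := T_le_Z' k x; have := Z'_le k x; lra.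
have Zself x : \sum_(k < n) (Z x - int_coord mu n k Z x +
    excess mu n Z (4 * (rho + b)) s2 k x) <= Z x.
  apply: (@le_trans _ _ (\sum_(k < n) (real_sup_sum x - Z' x k + b))); last first.
    rewrite big_split /= sumr_const card_ord -mulr_natl lerD2r.
    exact: sum_T_Z'.
  apply: ler_sum => k _.
  suff : excess mu n Z (4 * (rho + b)) s2 k x <= cT k x - Z' x k + b.
    by rewrite cZ /Z; lra.
  rewrite ge_max; apply/andP; split; first by have := Z'_le k x; lra.
  by rewrite ler_pdivrMr// mulrC VE V_le.
have := self_bounded_tail mu n Z (rho + b) (4 * (rho + b)) s2 bZ r4 s20 Zr Zself l s l0.
rewrite EZ => /(_ ltac:(lra) ltac:(lra)) H.
have := bexp_real_sup_sum_ge => ETb.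
apply: le_trans (H ltac:(lra)).
have mA (f : n.-tuple S -> R) (a : R) : bmeas f -> measurable [set x | (a < f x)%R].
  move=> [/measurable_EFinP mf _].
  have := emeasurable_fun_o_infty measurableT mf a%:E.
  by rewrite setTI (_ : [set x | _] = [set x | a < f x]).
apply: le_measure; rewrite ?inE; [exact: mA|exact: mA|].
move=> x /= /lt_le_trans; apply; rewrite lerDl mulr_ge0//.
Qed.

End bounded_class.

(** * Exponential moments *)

Section exponential_interpolation.
Context {R : realType}.
Implicit Types l p u v : R.

Lemma ln_ge1BV (x : R) : 0 < x -> 1 - x^-1 <= ln x.
Proof.
move=> x0; have := @le_ln1Dx R (x^-1 - 1); rewrite subrKC lnV ?posrE//.
have := x0; rewrite -invr_gt0 => xV0.
move=> /(_ ltac:(lra)); lra.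
Qed.

Lemma expRB1_le v : 0 <= v -> v <= 1 -> expR v - 1 <= expR 1 * v.
Proof.
move=> v0 v1; have h := expR_ge1Dx (- v).
have ev := expR_gt0 v.
have : expR v * (1 - v) <= 1.
  apply: (@le_trans _ _ (expR v * expR (- v))); first by rewrite ler_pM2l.
  by rewrite -expRD subrr expR0.
have : expR v * v <= expR 1 * v by rewrite ler_wpM2r// ler_expR.
lra.
Qed.

Lemma ln_expR1M p : 0 < p -> ln (expR 1 * p) = 1 + ln p.
Proof. by move=> p0; rewrite lnM ?posrE ?expR_gt0// expRK. Qed.

(** Source of the factor p / log(ep). With [l = p * a] and [y = ln l >= 1] the claim reads
    [a * (1 + y - ln a) <= y * expR a]; it follows from [a - a * ln a <= 1 <= y] and
    [1 + a <= expR a]. *)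
Lemma log_tradeoff p l : 2 <= p -> expR 1 <= l ->
  l * ln (expR 1 * p) <= p * ln l * expR (l / p).
Proof.
move=> p2 le.
have p0 : 0 < p by lra.
have l0 : 0 < l by apply: lt_le_trans le; exact: expR_gt0.
rewrite ln_expR1M//.
set a := l / p.
have a0 : 0 < a by rewrite divr_gt0.
set y := ln l.
have y1 : 1 <= y by rewrite /y -(expRK 1) ler_ln ?posrE ?expR_gt0.
have lnpE : ln p = y - ln a by rewrite /a /y lnM ?posrE ?invr_gt0// lnV ?posrE//; ring.
have -> : l = p * a by rewrite /a; field; rewrite gt_eqF.
rewrite -(mulrA p a) -(mulrA p y) ler_pM2l// lnpE.
have h1 := ln_ge1BV a a0.
have : a * (1 - a^-1) <= a * ln a by rewrite ler_pM2l.
rewrite mulrBr mulr1 mulfV ?gt_eqF// => h2.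
have h3 : y * (1 + a) <= y * expR a by rewrite ler_wpM2l ?expR_ge1Dx//; lra.
lra.
Qed.

(* Linear in [u] as long as [expR (l * u)] is at most of order [l * u], while
   beyond that point [log_tradeoff] makes the power [u `^ p] large enough. *)
Lemma expR_interpolation p l u : 2 <= p -> expR 1 <= l -> 0 <= u -> u <= 1 ->
  expR (l * u) - 1 <=
  l ^+ 2 * u + expR (2 * l) * (p / ln (expR 1 * p)) `^ p * u `^ p.
Proof.
move=> p2 le u0 u1.
have p0 : 0 < p by lra.
have l0 : 0 < l by apply: lt_le_trans le; exact: expR_gt0.
set L := p / _; set v := l * u.
have lnp0 : 0 < ln (expR 1 * p).
  rewrite ln_expR1M//; have : 0 <= ln p by rewrite ln_ge0//; lra.
  lra.
have L0 : 0 < L by rewrite divr_gt0.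
have -> : l ^+ 2 * u = l * v by rewrite /v; ring.
have v0 : 0 <= v by rewrite mulr_ge0// ltW.
have rhs0 : 0 <= expR (2 * l) * L `^ p * u `^ p.
  by rewrite !mulr_ge0 ?expR_ge0 ?powR_ge0.
have [h|h] := leP (expR v - 1) (l * v); first lra.
(* From here on the linear term alone does not suffice. This forces [v > 1], hence [expR v > l],
   that is, [v] exceeds [ln l]. *)
have v1 : 1 < v.
  rewrite ltNge; apply/negP => v1; have := expRB1_le v v0 v1.
  have : expR 1 * v <= l * v by rewrite ler_wpM2r.
  lra.
have lnlv : ln l <= v.
  rewrite -ler_expR lnK ?posrE//.
  have : l * 1 <= l * v by rewrite ler_pM2l// ltW.
  lra.
have u0' : 0 < u.
  rewrite lt_def u0 andbT; apply/eqP => uE.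
  by move: v1; rewrite /v uE mulr0; lra.
have vl : v <= l by rewrite /v ler_piMr// ltW.
suff : expR v <= expR (2 * l) * L `^ p * u `^ p.
  have : 0 <= l * v by rewrite mulr_ge0// ltW.
  lra.
(* Raised to the power [p] this gives [expR (- l)]; half of the factor [expR (2 * l)] compensates it
   and the other half dominates [expR v]. *)
have Lu : expR (- (l / p)) <= L * u.
  rewrite expRN -[leLHS]mul1r ler_pdivrMr ?expR_gt0//.
  have h1 := log_tradeoff p l p2 le.
  have uE : u = v / l by rewrite /v; field; rewrite gt_eqF.
  have -> : L * u * expR (l / p) =
      p * v * expR (l / p) / (l * ln (expR 1 * p)).
    rewrite [in LHS]uE /L; set e := expR (l / p); set w := ln _ in lnp0 *.
    by field; rewrite !gt_eqF.
  rewrite ler_pdivlMr ?mulr_gt0// mul1r; apply: (le_trans h1).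
  by rewrite ler_pM2r ?expR_gt0// ler_pM2l.
rewrite -mulrA -powRM ?(ltW L0)//.
apply: (@le_trans _ _ (expR (2 * l) * (expR (- (l / p))) `^ p)).
  rewrite -expRM (_ : - (l / p) * p = - l); last by field; rewrite gt_eqF.
  by rewrite -expRD ler_expR; lra.
rewrite ler_pM2l ?expR_gt0//.
by rewrite ge0_ler_powR ?nnegrE ?expR_ge0 ?(mulr_ge0 (ltW L0))//; lra.
Qed.

End exponential_interpolation.

Section product_integrals.
Context {d} {S : measurableType d} {R : realType} (mu : probability S R).

Lemma measurable_prod_tnth n (g : 'I_n -> S -> \bar R) :
  (forall k, measurable_fun [set: S] (g k)) ->
  measurable_fun [set: n.-tuple S]
    (fun x => (\big[*%E/1%E]_(k < n) g k (tnth x k))%E).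
Proof.
move=> mg; have : forall s : seq 'I_n, measurable_fun [set: n.-tuple S]
    (fun x => (\big[*%E/1%E]_(k <- s) g k (tnth x k))%E).
  elim=> [|k s IH].
    by under eq_fun do rewrite big_nil; exact: measurable_cst.
  under eq_fun do rewrite big_cons.
  apply: emeasurable_funM => //.
  by apply: measurableT_comp => //; exact: measurable_tnth.
exact.
Qed.

Lemma ge0_integral_prod n (g : 'I_n -> S -> \bar R) :
  (forall k, measurable_fun [set: S] (g k)) -> (forall k y, (0 <= g k y)%E) ->
  (\int[tprod mu n]_x \big[*%E/1]_(k < n) g k (tnth x k) =
   \big[*%E/1]_(k < n) \int[mu]_y g k y)%E.
Proof.
elim: n g => [|n IH] g mg g0.
  under eq_integral do rewrite big_ord0.
  by rewrite big_ord0 integral_cst// mul1e; exact: probability_setT.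
have p0 (s : 'I_n.+1 -> \bar R) : (forall k, 0 <= s k)%E ->
  (0 <= \big[*%E/1%E]_(k < n.+1) s k)%E.
  by move=> s0; apply: prode_ge0.
rewrite ge0_integral_tprodS; last 2 first.
- exact: measurable_prod_tnth.
- by move=> x; apply: prode_ge0.
rewrite big_ord_recl -(IH (fun k => g (lift ord0 k)))//.
rewrite -ge0_integralZr//; last by apply: integral_ge0 => x _; exact: prode_ge0.
apply: eq_integral => x _.
rewrite (eq_integral (fun y =>
    g ord0 x * \big[*%E/1]_(k < n) g (lift ord0 k) (tnth y k))%E); last first.
  by move=> y _; rewrite big_ord_recl; under eq_bigr do rewrite tnthS.
rewrite ge0_integralZl//.
- exact: (measurable_prod_tnth n (fun k => g (lift ord0 k))).
- by move=> y _; exact: prode_ge0.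
Qed.

(** Applying [1 + x <= expR x] to the one-coordinate moment generating function leaves the integral
    of [expR (l * f) - 1], which is what [expR_interpolation] estimates. *)
Lemma chernoff_tprod n (f : S -> R) l s : bmeas f -> 0 <= l ->
  (tprod mu n [set x | (s < \sum_(k < n) f (tnth x k))%R] <=
   (expR (- (l * s) + n%:R * \int[mu]_y (expR (l * f y) - 1)))%:E)%E.
Proof.
move=> bf l0.
have bfk k : bmeas (fun x : n.-tuple S => f (tnth x k)).
  by apply: (bmeas_comp (fun x => tnth x k)) => //; exact: measurable_tnth.
pose F x := \sum_(k < n) f (tnth x k).
have bF : bmeas F by exact: bmeas_sum.
have mA : measurable [set x | s < F x].
  have /measurable_EFinP mF := bF.1.
  have := emeasurable_fun_o_infty measurableT mF s%:E.
  by rewrite setTI (_ : [set x | _] = [set x | s < F x]).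
have bel : bmeas (fun y => expR (l * f y)) by bm.
apply: (@le_trans _ _ (expR (- (l * s)) * \int[tprod mu n]_x expR (l * F x))%:E).
  rewrite -bexpZ; [|by bm]; rewrite -EFin_bmeas; [|by bm].
  rewrite -[X in (tprod mu n X <= _)%E]setIT -integral_indic//.
  apply: ge0_le_integral => //.
  - exact/measurable_EFinP/measurable_indic.
  - apply/measurable_EFinP.
    by have [] : bmeas (fun x => expR (- (l * s)) * expR (l * F x)) by bm.
  - move=> x _; rewrite lee_fin indicE; case: (boolP (x \in _)) => [|_]; last first.
      by rewrite mulr_ge0 ?expR_ge0.
    rewrite inE /= => xA; rewrite -expRD -[leLHS]expR0 ler_expR addrC subr_ge0.
    by rewrite ler_wpM2l// ltW.
rewrite lee_fin expRD ler_pM2l ?expR_gt0//.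
have -> : \int[tprod mu n]_x expR (l * F x) = (\int[mu]_y expR (l * f y)) ^+ n.
  apply: EFin_inj; rewrite -EFin_bmeas; [|by bm].
  rewrite -[n in RHS]card_ord -prodr_const.
  rewrite (big_morph EFin (id1 := 1%E) (op1 := *%E))//.
  rewrite -EFin_bmeas// -(ge0_integral_prod n (fun=> fun y => (expR (l * f y))%:E)).
  - apply: eq_integral => x _; rewrite /F mulr_sumr expR_sum.
    by rewrite (big_morph EFin (id1 := 1%E) (op1 := *%E)).
  - by move=> _; apply/measurable_EFinP; case: bel.
  - by move=> _ y; rewrite lee_fin expR_ge0.
rewrite expRM_natl; apply: lerXn2r; rewrite ?nnegrE ?expR_ge0//.
  by apply: Rintegral_ge0 => y _; exact: expR_ge0.
rewrite bexpB; [|by bm|by bm]; rewrite bexp_cst.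
by have := expR_ge1Dx (\int[mu]_x expR (l * f x) - 1); rewrite subrKC.
Qed.

End product_integrals.

(** * Large coordinates *)

Lemma sume_ord_const {R : realType} n (c : \bar R) :
  (\sum_(k < n) c = n%:R%:E * c)%E.
Proof.
rewrite mule_natl; elim: n => [|n IH]; first by rewrite big_ord0.
by rewrite big_ord_recl IH muleS.
Qed.

Section large_coordinate.
Local Open Scope ereal_scope.
Context {d} {S : measurableType d} {R : realType} (mu : probability S R).
Variables (n : nat) (phi : S -> \bar R) (rho : R).
Hypothesis mphi : measurable_fun [set: S] phi.

Let small y : \bar R := if phi y <= rho%:E then 1 else 0.

Let measurable_small : measurable_fun [set: S] small.
Proof.
apply: measurable_fun_ifT => //; exact: measurable_fun_lee.
Qed.

Let small_ge0 y : 0 <= small y.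
Proof. by rewrite /small; case: ifP. Qed.

Let q := \int[mu]_y small y.

Let q_le1 : q <= 1.
Proof.
apply: (@le_trans _ _ (\int[mu]_y cst 1 y)).
  by apply: ge0_le_integral => // y _; rewrite /small; case: ifP.
by rewrite integral_cst// mul1e; exact: sprobability_setT.
Qed.

Let q_ge0 : 0 <= q.
Proof. exact: integral_ge0. Qed.

(** The product is the probability that all coordinates are small. Integrating the pointwise bound
    of [rho] by [M] plus [rho] times the indicator of that event shows that it is at least 7/8. *)
Lemma prod_small_ge (m : R) (M : n.-tuple S -> \bar R) : (0 < m)%R ->
  rho = (8 * m)%R -> measurable_fun setT M -> (forall x, 0 <= M x) ->
  (forall x k, phi (tnth x k) <= M x) ->
  \int[tprod mu n]_x M x = m%:E ->
  (1 / 2)%:E <= \big[*%E/1]_(k < n) q.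
Proof.
move=> m0 rhoE mM M0 Mk iM.
rewrite -(ge0_integral_prod mu n (fun=> small))//.
set J := \int[_]_x _.
have mprod := measurable_prod_tnth n (fun=> small) (fun=> measurable_small).
have prod0 (x : n.-tuple S) : 0 <= \big[*%E/1]_(k < n) small (tnth x k).
  exact: prode_ge0.
have J0 : 0 <= J by exact: integral_ge0.
have : \int[tprod mu n]_x cst rho%:E x <= m%:E + rho%:E * J.
  rewrite -iM -ge0_integralZl//; last by rewrite lee_fin rhoE mulr_ge0// ltW.
  rewrite -ge0_integralD//; last 2 first.
  - by move=> x _; rewrite mule_ge0// lee_fin rhoE mulr_ge0// ltW.
  - by apply: emeasurable_funM.
  apply: ge0_le_integral => //.
  - by move=> x _; rewrite lee_fin rhoE mulr_ge0// ltW.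
  - by apply: emeasurable_funD => //; exact: emeasurable_funM.
  move=> x _ /=; have [H|/existsNP[k kH]] := pselect (forall k, phi (tnth x k) <= rho%:E).
    rewrite big1 ?mule1 ?leeDr// => k _; by rewrite /small H.
  apply: (@le_trans _ _ (M x)).
    apply: le_trans (Mk x k); apply/ltW; rewrite ltNge; exact/negP.
  by rewrite leeDl// mule_ge0// lee_fin rhoE mulr_ge0// ltW.
rewrite integral_cst//= [X in _ * X](_ : _ = 1) ?mule1; last exact: probability_setT.
case: J J0 => [j| |]//= j0; last by rewrite leey.
rewrite -EFinM -EFinD !lee_fin rhoE => h; have : (7 / 8 * m <= m * j)%R by lra.
by rewrite mulrC ler_pM2l//; lra.
Qed.

(* Conditionally on all other coordinates being small, the [k]-th coordinate
   keeps its law; these events are disjoint when the [k]-th coordinate is large. *)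
Lemma sum_large_le (G : S -> \bar R) (H : n.-tuple S -> \bar R) :
  (1 / 2)%:E <= \big[*%E/1]_(k < n) q ->
  measurable_fun setT G -> (forall y, 0 <= G y) ->
  measurable_fun setT H -> (forall x, 0 <= H x) ->
  (forall y, phi y <= rho%:E -> G y = 0) ->
  (forall x k, (forall j, j != k -> phi (tnth x j) <= rho%:E) ->
    ~~ (phi (tnth x k) <= rho%:E) -> G (tnth x k) <= H x) ->
  n%:R%:E * \int[mu]_y G y <= 2%:E * \int[tprod mu n]_x H x.
Proof.
move=> qn mG G0 mH H0 Gsmall GH.
pose g (k j : 'I_n) := if j == k then G else small.
have mg k j : measurable_fun [set: S] (g k j) by rewrite /g; case: ifP.
have g0 k j y : 0 <= g k j y by rewrite /g; case: ifP.
pose term k (x : n.-tuple S) := \big[*%E/1]_(j < n) g k j (tnth x j).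
have termE k x : term k x = G (tnth x k) *
    \big[*%E/1]_(j < n | j != k) small (tnth x j).
  rewrite /term (bigD1 k)//= /g eqxx; congr (_ * _).
  by apply: eq_bigr => j /negbTE ->.
have term0 k x : 0 <= term k x by exact: prode_ge0.
have term_neq0 k x : term k x != 0 ->
    (forall j, j != k -> phi (tnth x j) <= rho%:E) /\
    ~~ (phi (tnth x k) <= rho%:E).
  move=> t0; split => [j jk|].
    apply/negPn/negP => pj; move/negP: t0; apply.
    by rewrite termE (bigD1 j)//= /small (negbTE pj) mul0e mule0.
  apply/negP => pk; move/negP: t0; apply.
  by rewrite termE Gsmall// mul0e.
have term_le x : \sum_(k < n) term k x <= H x.
  have [[k tk]|nk] := pselect (exists k, term k x != 0).
    rewrite (bigD1 k)//= big1 ?adde0; last first.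
      move=> i ik; apply/eqP/negPn/negP => ti.
      have [hk _] := term_neq0 _ _ tk; have [_ /negP] := term_neq0 _ _ ti.
      by apply; exact: hk.
    have [hk hk'] := term_neq0 _ _ tk.
    apply: le_trans (GH x k hk hk').
    rewrite termE -[leRHS]mule1 lee_wpmul2l//.
    rewrite big1// => j jk; by rewrite /small hk.
  rewrite big1// => k _; apply/eqP/negPn/negP => tk; apply: nk; by exists k.
(* The integral of [term k] has only [n - 1] factors [q]; the missing one can be restored because
   [q <= 1]. *)
have int_term k : (1 / 2)%:E * \int[mu]_y G y <= \int[tprod mu n]_x term k x.
  rewrite ge0_integral_prod// (bigD1 k)//= {1}/g eqxx muleC lee_wpmul2l//.
    exact: integral_ge0.
  apply: (le_trans qn); rewrite (bigD1 k)//=.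
  rewrite (_ : \big[*%E/1]_(j < n | j != k) \int[mu]_y g k j y =
     \big[*%E/1]_(j < n | j != k) q); last first.
    by apply: eq_bigr => j /negbTE jk; rewrite /g jk.
  rewrite -[leRHS]mul1e lee_wpmul2r//.
  by apply: prode_ge0.
have : \sum_(k < n) ((1 / 2)%:E * \int[mu]_y G y) <= \int[tprod mu n]_x H x.
  apply: (@le_trans _ _ (\sum_(k < n) \int[tprod mu n]_x term k x)).
    exact: lee_sum.
  rewrite -ge0_integral_sum//; last first.
    by move=> k; exact: measurable_prod_tnth.
  apply: ge0_le_integral => //.
  - by move=> x _; exact: sume_ge0.
  - by apply: emeasurable_sum => k; exact: measurable_prod_tnth.
rewrite sume_ord_const => h.
have -> : \int[mu]_y G y = 2%:E * ((1 / 2)%:E * \int[mu]_y G y).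
  by rewrite muleA -EFinM mul1r divff// mul1e.
by rewrite muleCA lee_wpmul2l.
Qed.

End large_coordinate.

(** * Truncation *)

Lemma ge0_integral_tnth {d} {S : measurableType d} {R : realType}
    (mu : probability S R) n (k : 'I_n) (g : S -> \bar R) :
  measurable_fun setT g -> (forall y, 0 <= g y)%E ->
  (\int[tprod mu n]_x g (tnth x k) = \int[mu]_y g y)%E.
Proof.
move=> mg g0.
pose h (j : 'I_n) := if j == k then g else cst 1%E.
have -> : (\int[mu]_y g y = \big[*%E/1]_(j < n) \int[mu]_y h j y)%E.
  rewrite (bigD1 k)//= big1 ?mule1; first by rewrite /h eqxx.
  move=> j /negbTE jk; rewrite /h jk integral_cst// mul1e.
  exact: probability_setT.
rewrite -(ge0_integral_prod mu n h); last 2 first.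
- by move=> j; rewrite /h; case: ifP.
- by move=> j y; rewrite /h; case: ifP => //= _; exact: lee01.
apply: eq_integral => x _; rewrite (bigD1 k)//= {1}/h eqxx big1 ?mule1//.
by move=> j /negbTE jk; rewrite /h jk.
Qed.

Section truncation.
Local Open Scope ereal_scope.
Context {d} {S : measurableType d} {R : realType} (mu : probability S R).
Variables (n : nat) (F : set (S -> R)) (m : R).
Hypotheses (n0 : (0 < n)%N) (F0 : F !=set0) (m0 : (0 < m)%R).
Hypothesis mF : forall f, F f -> measurable_fun [set: S] f.
Hypothesis cF : forall f, F f -> \int[mu]_y (f y)%:E = 0.
Hypothesis mM : measurable_fun [set: n.-tuple S] (@max_envelope _ S R n F).
Hypothesis mZ : measurable_fun [set: n.-tuple S] (@sup_sum _ S R n F).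

Let phi := @envelope _ S R F.
Let M := @max_envelope _ S R n F.
Let Z := @sup_sum _ S R n F.
Let rho := (8 * m)%R.
Let Y y := if phi y <= rho%:E then 0 else phi y.

Lemma abs_le_envelope f y : F f -> (`|f y|%R)%:E <= envelope F y.
Proof. by move=> Ff; apply: ereal_sup_ubound; exists f. Qed.

Lemma envelope_ge0 y : 0 <= envelope F y.
Proof.
have [f Ff] := F0; apply: le_trans (abs_le_envelope f y Ff).
by rewrite lee_fin.
Qed.

Lemma envelope_le_max x k : envelope F (tnth x k) <= @max_envelope _ S R n F x.
Proof. exact: (le_bigmax _ (fun k => envelope F (tnth x k))). Qed.

Lemma max_envelope_ge0 x : 0 <= @max_envelope _ S R n F x.
Proof.
exact: le_trans (envelope_ge0 _) (envelope_le_max x (Ordinal n0)).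
Qed.

(** Obtained from the measurability of the maximum on tuples: on constant tuples the maximum is the
    envelope itself. *)
Lemma measurable_envelope : measurable_fun [set: S] (@envelope _ S R F).
Proof.
have mdiag : measurable_fun [set: S] (fun y => [tuple y | k < n]).
  apply/measurable_fun_tnthP => k.
  rewrite (_ : _ \o _ = id)//.
  by apply/funext => y /=; rewrite tnth_mktuple.
rewrite (_ : envelope F = M \o (fun y => [tuple y | k < n])).
  exact: measurableT_comp.
apply/funext => y /=; apply/eqP; rewrite eq_le; apply/andP; split.
  have := envelope_le_max [tuple y | k < n] (Ordinal n0).
  by rewrite tnth_mktuple.
by apply: bigmax_le => [|k _]; rewrite ?leNye// tnth_mktuple.
Qed.

Let mphi : measurable_fun [set: S] phi := measurable_envelope.

Let rho_gt0 : (0 < rho)%R.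
Proof. by rewrite mulr_gt0. Qed.

Let mY : measurable_fun [set: S] Y.
Proof. by apply: measurable_fun_ifT => //; exact: measurable_fun_lee. Qed.

Let Y0 y : 0 <= Y y.
Proof. by rewrite /Y; case: ifP => // _; exact: envelope_ge0. Qed.

Hypothesis iM : \int[tprod mu n]_x max_envelope F x = m%:E.

Let q_n : (1 / 2)%:E <=
  \big[*%E/1]_(k < n) \int[mu]_y (if phi y <= rho%:E then 1 else 0).
Proof.
apply: (prod_small_ge mu n phi rho mphi m M) => //.
- exact: max_envelope_ge0.
- exact: envelope_le_max.
Qed.

Lemma exists_small : exists y, envelope F y <= (8 * m)%:E.
Proof.
apply: contrapT => /forallNP H.
suff q0 : \int[mu]_y (if phi y <= rho%:E then 1 else 0) = 0.
  move: q_n; rewrite q0 (bigD1 (Ordinal n0))//= mul0e lee_fin; lra.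
by apply: integral0_eq => y _; rewrite ifF//; apply/negP; exact: H.
Qed.

(** Applied to the identity and to the p-th power. The condition [h 0 = 0] is there because [Y]
    vanishes at small values, where the comparison with [M] says nothing. *)
Let Ymoment (h : \bar R -> \bar R) : measurable_fun setT h ->
  (forall y, 0 <= y -> 0 <= h y) -> h 0 = 0 ->
  (forall y z, 0 <= y -> y <= z -> h y <= h z) ->
  n%:R%:E * \int[mu]_y h (Y y) <= 2%:E * \int[tprod mu n]_x h (M x).
Proof.
move=> mh hge0 h0 hle.
apply: (sum_large_le mu n phi rho mphi (fun y => h (Y y))) => //.
- exact: measurableT_comp.
- by move=> y; exact: hge0.
- exact: measurableT_comp.
- by move=> x; apply: hge0; exact: max_envelope_ge0.
- by move=> y yr; rewrite /Y yr.
- move=> x k _ /negbTE pk; rewrite /Y pk; apply: hle.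
    exact: envelope_ge0.
  exact: envelope_le_max.
Qed.

Let yE : exists2 y : R, \int[mu]_z Y z = y%:E & (0 <= y /\ n%:R * y <= 2 * m)%R.
Proof.
have := Ymoment id (@measurable_id _ _ setT) (fun y h => h) erefl (fun y z _ h => h).
rewrite /= iM -EFinM.
have : 0 <= \int[mu]_z Y z by exact: integral_ge0.
case: (\int[mu]_z Y z) => [y| |]//.
  by rewrite -EFinM !lee_fin => *; exists y.
by rewrite gt0_muley// lte_fin ltr0n.
Qed.

Variable s0 : S.
Hypothesis s0_small : envelope F s0 <= (8 * m)%:E.

Let tau y := if phi y <= rho%:E then y else s0.

Let mtau : measurable_fun [set: S] tau.
Proof. by apply: measurable_fun_ifT => //; exact: measurable_fun_lee. Qed.

Let phi_tau y : phi (tau y) <= rho%:E.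
Proof. by rewrite /tau; case: ifP. Qed.

Let G := [set f \o tau | f in F].

Let f_tau f y : F f -> (`|f (tau y)| <= rho)%R.
Proof.
by move=> Ff; rewrite -lee_fin; apply: le_trans (phi_tau y); exact: abs_le_envelope.
Qed.

(** Where the truncation acts, [s0] is small and [y] is not, so [f s0] and [f y] are both bounded by
    [phi y], which is [Y y]. *)
Let diff_le f y : F f -> (`|f (tau y) - f y|%R)%:E <= Y y + Y y.
Proof.
move=> Ff; rewrite /tau /Y; case: ifPn => [_|]; first by rewrite subrr normr0 adde0.
rewrite -ltNge => pr.
apply: (@le_trans _ _ ((`|f s0|%R)%:E + (`|f y|%R)%:E)).
  by rewrite -EFinD lee_fin ler_normB.
apply: leeD; last exact: abs_le_envelope.
apply: le_trans (abs_le_envelope f s0 Ff) _; apply: (le_trans s0_small).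
exact: ltW.
Qed.

Let mtauf f : F f -> measurable_fun [set: S] (f \o tau).
Proof. by move=> Ff; apply: measurableT_comp => //; exact: mF. Qed.

Let btauf f : F f -> bmeas (f \o tau).
Proof.
by move=> Ff; split; [exact: mtauf|exists rho => y; exact: f_tau].
Qed.

Let int_f f : F f -> mu.-integrable setT (EFin \o f).
Proof.
move=> Ff; apply/integrableP; split; first exact/measurable_EFinP/mF.
have [y yE' _] := yE.
apply: (@le_lt_trans _ _ (\int[mu]_z (rho%:E + Y z))).
  apply: ge0_le_integral => //.
  - by apply/measurable_EFinP; apply: measurableT_comp => //; exact: mF.
  - exact: emeasurable_funD.
  - move=> z _ /=; apply: le_trans (abs_le_envelope f z Ff) _.
    rewrite /Y -/phi; case: ifP => [?|_]; first by rewrite adde0.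
    by rewrite leeDr// lee_fin ltW.
rewrite ge0_integralD//; last by move=> *; rewrite lee_fin ltW.
rewrite yE' integral_cst// [X in _ * X](_ : _ = 1) ?mule1 -?EFinD ?ltry//.
exact: probability_setT.
Qed.

(** As [f] is centred, the mean of [f \o tau] is that of its difference to [f], at most twice the
    mean of [Y]. *)
Let mean_le f : F f -> (`|\int[mu]_y f (tau y)| <= 4 * m / n%:R)%R.
Proof.
move=> Ff; have [y yE' [y0 ny]] := yE.
rewrite -lee_fin EFin_normr_Rintegral//; last exact: (bmeas_integrable _ _ (btauf _ Ff)).
have bint := bmeas_integrable mu _ (btauf _ Ff).
have -> : \int[mu]_z (f (tau z))%:E = \int[mu]_z ((f (tau z))%:E - (f z)%:E).
  by rewrite (integralB_EFin measurableT bint (int_f _ Ff)) (cF f Ff) sube0.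
have md : measurable_fun setT (fun z => (f (tau z))%:E - (f z)%:E).
  apply/measurable_EFinP/measurable_funB; [exact: mtauf|exact: mF].
apply: (le_trans (le_abse_integral _ _ _)) => //.
apply: (@le_trans _ _ (\int[mu]_z (Y z + Y z))).
  apply: ge0_le_integral => //.
  - exact: measurableT_comp.
  - exact: emeasurable_funD.
  - by move=> z _; exact: diff_le.
rewrite ge0_integralD// yE' -EFinD lee_fin ler_pdivlMr ?ltr0n//; lra.
Qed.

Variable sigma : R.
Hypothesis vF : forall f, F f ->
  n%:R%:E * \int[mu]_y ((f y) ^+ 2)%:E <= (sigma ^+ 2)%:E.

Let s2 := ((sigma ^+ 2 + 16 * m ^+ 2) / n%:R)%R.

(** A substituted value satisfies [f s0 ^+ 2 <= rho ^+ 2 <= rho * phi y]. Hence the truncation adds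
    at most [rho * Y], whose mean times [n] is at most [8 * m * (2 * m)]. *)
Let var_le f : F f -> (\int[mu]_y (f (tau y) ^+ 2) <= s2)%R.
Proof.
move=> Ff; have [y yE' [y0 ny]] := yE.
rewrite ler_pdivlMr ?ltr0n// mulrC -lee_fin EFinM.
have bf2 : bmeas (fun y => f (tau y) ^+ 2)%R by exact: (bmeasX _ _ (btauf _ Ff)).
rewrite -EFin_bmeas//.
have mf2 : measurable_fun setT (fun y => (f y ^+ 2)%:E).
  by apply/measurable_EFinP; apply: measurable_funX; exact: mF.
apply: (@le_trans _ _ (n%:R%:E * (\int[mu]_z ((f z ^+ 2)%:E + rho%:E * Y z)))).
  apply: lee_wpmul2l; first by rewrite lee_fin.
  apply: ge0_le_integral => //.
  - by move=> z _; rewrite lee_fin sqr_ge0.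
  - by apply/measurable_EFinP; case: bf2.
  - by apply: emeasurable_funD => //; exact: emeasurable_funM.
  - move=> z _; rewrite /tau /Y; case: ifPn => [_|]; first by rewrite mule0 adde0.
    rewrite -ltNge => pr.
    apply: (@le_trans _ _ (rho%:E * phi z)); last by rewrite leeDr// lee_fin sqr_ge0.
    apply: (@le_trans _ _ (rho%:E * rho%:E)).
      rewrite -EFinM lee_fin -expr2 -[leLHS]real_normK ?num_real// ler_sqr ?nnegrE ?(ltW rho_gt0)//.
      by rewrite -lee_fin; apply: le_trans s0_small; exact: abs_le_envelope.
    by apply: lee_wpmul2l; [rewrite lee_fin ltW|exact: ltW].
rewrite ge0_integralD//; last 3 first.
- by move=> z _; rewrite lee_fin sqr_ge0.
- by move=> z _; rewrite mule_ge0// lee_fin ltW.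
- exact: emeasurable_funM.
rewrite ge0_integralZl//; last by rewrite lee_fin ltW.
rewrite ge0_muleDr; last 2 first.
- by apply: integral_ge0 => z _; rewrite lee_fin sqr_ge0.
- by rewrite yE' -EFinM lee_fin mulr_ge0// ltW.
rewrite EFinD; apply: leeD; first exact: vF.
rewrite yE' -!EFinM lee_fin mulrCA.
have : (rho * (n%:R * y) <= rho * (2 * m))%R by rewrite ler_pM2l.
rewrite /rho expr2; lra.
Qed.

Let mapt (x : n.-tuple S) : n.-tuple S := [tuple tau (tnth x k) | k < n].

Let mmapt : measurable_fun [set: n.-tuple S] mapt.
Proof.
apply/measurable_fun_tnthP => k.
rewrite (_ : _ \o _ = fun x => tau (tnth x k)); last first.
  by apply/funext => x /=; rewrite tnth_mktuple.
apply: (@measurableT_comp _ _ _ _ _ _ tau _ (fun x => tnth x k)) => //.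
exact: measurable_tnth.
Qed.

Let T := real_sup_sum n G.

Let sum_le x f : F f -> (`|\sum_(k < n) f (tau (tnth x k))| <= n%:R * rho)%R.
Proof.
move=> Ff; apply: (le_trans (ler_norm_sum _ _ _)).
rewrite mulr_natl -[n in leRHS]card_ord -sumr_const.
by apply: ler_sum => k _; exact: f_tau.
Qed.

Let TE x : (T x)%:E = Z (mapt x).
Proof.
rewrite /T /real_sup_sum -ereal_sup_EFin.
- congr ereal_sup; apply/seteqP; split => [_ [_ [_ [f Ff <-] <-] <-]|_ [f Ff <-]].
    exists f => //; congr EFin; apply: eq_bigr => k _.
    by rewrite tnth_mktuple.
  exists (\sum_(k < n) f (tau (tnth x k)))%R.
    by exists (f \o tau) => //; exists f.
  by congr EFin; apply: eq_bigr => k _; rewrite tnth_mktuple.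
- exists (n%:R * rho)%R => _ [_ [f Ff <-] <-].
  exact: le_trans (ler_norm _) (sum_le x f Ff).
- have [f Ff] := F0; exists (\sum_(k < n) f (tau (tnth x k)))%R.
  by exists (f \o tau) => //; exists f.
Qed.

Let mT : measurable_fun [set: n.-tuple S] T.
Proof.
apply/measurable_EFinP; rewrite (_ : _ \o _ = Z \o mapt).
  exact: measurableT_comp.
by apply/funext => x /=; rewrite TE.
Qed.

Let bT : bmeas T.
Proof.
split => //; exists (n%:R * rho)%R => x.
rewrite ler_norml -!lee_fin TE.
have H f : F f -> (`|\sum_(k < n) f (tnth (mapt x) k)| <= n%:R * rho)%R.
  move=> Ff; have := sum_le x f Ff.
  by under [in X in _ -> X]eq_bigr do rewrite tnth_mktuple.
have [f Ff] := F0.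
apply/andP; split.
  apply: (@le_trans _ _ (\sum_(k < n) f (tnth (mapt x) k))%R%:E).
    by have := H f Ff; rewrite ler_norml lee_fin => /andP[].
  by apply: ereal_sup_ubound; exists f.
apply: ge_ereal_sup => _ [g Fg <-]; rewrite lee_fin.
exact: le_trans (ler_norm _) (H g Fg).
Qed.

Let W (x : n.-tuple S) := \sum_(k < n) (Y (tnth x k) + Y (tnth x k)).

Let W0 x : 0 <= W x.
Proof. by apply: sume_ge0 => k _; rewrite adde_ge0. Qed.

Let mYk k : measurable_fun [set: n.-tuple S] (fun x => Y (tnth x k)).
Proof.
apply: (@measurableT_comp _ _ _ _ _ _ Y _ (fun x => tnth x k)) => //.
exact: measurable_tnth.
Qed.

Let mW : measurable_fun [set: n.-tuple S] W.
Proof. by apply: emeasurable_sum => k; exact: emeasurable_funD. Qed.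

Let iW : \int[tprod mu n]_x W x <= (4 * m)%:E.
Proof.
have [y yE' [y0 ny]] := yE.
rewrite ge0_integral_sum//; last 2 first.
- by move=> k; exact: emeasurable_funD.
- by move=> k x _; rewrite adde_ge0.
rewrite (eq_bigr (fun=> (y + y)%:E)); last first.
  move=> k _; rewrite ge0_integralD//.
  by rewrite (ge0_integral_tnth mu n k Y)// yE'.
rewrite sume_ord_const -EFinM lee_fin; lra.
Qed.

Let Z_le x : Z x <= (T x)%:E + W x.
Proof.
rewrite TE; apply: ge_ereal_sup => _ [f Ff <-].
apply: (@le_trans _ _ ((\sum_(k < n) f (tnth (mapt x) k))%R%:E + W x)).
  rewrite -!sumEFin /W -big_split /=; apply: lee_sum => k _.
  rewrite tnth_mktuple; set y := tnth x k.
  apply: (@le_trans _ _ ((f (tau y))%:E + (`|f (tau y) - f y|%R)%:E)).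
    rewrite -EFinD lee_fin; have := ler_norm (- (f (tau y) - f y)).
    by rewrite normrN; lra.
  by rewrite leeD2l// diff_le.
by apply: leeD => //; apply: ereal_sup_ubound; exists f.
Qed.

Let T_le x : (T x)%:E <= Z x + W x.
Proof.
rewrite TE; apply: ge_ereal_sup => _ [f Ff <-].
apply: (@le_trans _ _ ((\sum_(k < n) f (tnth x k))%R%:E + W x)).
  rewrite -!sumEFin /W -big_split /=; apply: lee_sum => k _.
  rewrite tnth_mktuple; set y := tnth x k.
  apply: (@le_trans _ _ ((f y)%:E + (`|f (tau y) - f y|%R)%:E)).
    by rewrite -EFinD lee_fin; have := ler_norm (f (tau y) - f y); lra.
  by rewrite leeD2l// diff_le.
by apply: leeD => //; apply: ereal_sup_ubound; exists f.
Qed.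

Let ET := (\int[tprod mu n]_x T x)%R.

Let G0 : G !=set0.
Proof. by have [f Ff] := F0; exists (f \o tau), f. Qed.

Let mG g : G g -> measurable_fun [set: S] g.
Proof. by move=> [f Ff <-]; exact: mtauf. Qed.

Let G_rho g x : G g -> (`|g x| <= rho)%R.
Proof. by move=> [f Ff <-]; exact: f_tau. Qed.

Let G_mean g : G g -> (`|\int[mu]_x g x| <= 4 * m / n%:R)%R.
Proof. by move=> [f Ff <-]; exact: mean_le. Qed.

Let G_var g : G g -> (\int[mu]_x (g x ^+ 2) <= s2)%R.
Proof. by move=> [f Ff <-]; exact: var_le. Qed.

Let intW : (tprod mu n).-integrable setT W.
Proof.
apply/integrableP; split => //.
under eq_integral do rewrite gee0_abs//.
exact: le_lt_trans iW (ltry _).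
Qed.

Let intZ : (tprod mu n).-integrable setT Z.
Proof.
apply: (@le_integrable _ _ _ _ _ measurableT _ (fun x => `|(T x)%:E| + W x)) => //.
  move=> x _; rewrite [leRHS]gee0_abs ?adde_ge0//.
  have := Z_le x; have := T_le x; have := W0 x.
  case: (W x) => [w| |]// w0; last by move=> _ _; rewrite addey// leey.
  case: (Z x) => [z| |]//=.
  rewrite -!EFinD !lee_fin => h1 h2; rewrite ler_norml.
  have := ler_norm (T x); have := ler_norm (- T x); rewrite normrN.
  by rewrite lee_fin in w0; move=> ? ?; apply/andP; split; lra.
apply: integrableD => //; apply: integrable_abse.
exact: bmeas_integrable.
Qed.

(** One [4 * m] is the mean of the truncation error [W], the other is [n] times the bound on the
    means of the truncated functions. *)
Let EZ_bounds : exists2 z : R, \int[tprod mu n]_x Z x = z%:E &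
  (ET <= z + 4 * m)%R /\ (- (8 * m) <= z)%R.
Proof.
have fZ := integrable_fin_num measurableT intZ.
exists (fine (\int[tprod mu n]_x Z x)); first by rewrite fineK.
have h : (ET <= fine (\int[tprod mu n]_x Z x) + 4 * m)%R.
  rewrite -lee_fin EFinD (fineK fZ) /ET -EFin_bmeas//.
  apply: (@le_trans _ _ (\int[tprod mu n]_x (Z x + W x))).
    apply: le_integral => //.
    - exact: bmeas_integrable.
    - exact: integrableD.
  by rewrite integralD// leeD2l.
split => //.
have := bexp_real_sup_sum_ge mu n G rho (4 * m / n%:R)%R G0 mG G_rho G_mean mT.
rewrite -/ET mulrC divfK; last by rewrite pnatr_eq0 -lt0n.
by lra.
Qed.

Let D t := (2 * sigma ^+ 2 + 64 * t * m)%R.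

Let T_tail t : (0 < t)%R -> (64 * m <= t)%R ->
  tprod mu n [set x | (2 * (ET + 4 * m) + 9 * t < T x)%R] <=
  (expR (- (t ^+ 2 / D t)))%:E.
Proof.
move=> t0 mt.
have n1 : (1 <= n%:R :> R)%R by rewrite ler1n.
have nn0 : (n%:R != 0 :> R)%R by rewrite pnatr_eq0 -lt0n.
have sg0 := sqr_ge0 sigma.
have tm0 : (0 < t * m)%R by rewrite mulr_gt0.
have D0 : (0 < D t)%R by rewrite /D; lra.
pose b := (4 * m / n%:R)%R.
have b0 : (0 <= b)%R by rewrite divr_ge0// mulr_ge0// ltW.
have b4 : (b <= 4 * m)%R.
  by rewrite ler_pdivrMr ?ltr0n// ler_peMr// mulr_ge0// ltW.
have rb0 : (0 < rho + b)%R by rewrite ltr_wpDr.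
have s20 : (0 <= s2)%R.
  by rewrite divr_ge0// addr_ge0// mulr_ge0// sqr_ge0.
(* With [e = t ^+ 2 / D t], the linear part of the exponent is [- (9 / 8) * e] and the quadratic
   part at most [e / 8]; this is where the [9 * t] comes from. *)
pose l := (t / (8 * D t))%R.
have l0 : (0 < l)%R by rewrite divr_gt0// mulr_gt0.
have lr : (32 * (rho + b) * l <= 1)%R.
  rewrite /l mulrA ler_pdivrMr ?mulr_gt0// mul1r.
  have : ((rho + b) * t <= 12 * m * t)%R.
    by rewrite ler_pM2r// /rho; lra.
  by rewrite /D; lra.
have := real_sup_sum_tail mu n G rho b s2 G0 b0 rb0 s20 mG G_rho G_mean G_var mT
  l (9 * t)%R l0 lr.
rewrite -/ET -/T [(n%:R * b)%R]mulrC divfK// [(n%:R * s2)%R]mulrC divfK//.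
move=> /le_trans; apply; rewrite lee_fin ler_expR.
set e := (t ^+ 2 / D t)%R.
have e0 : (0 <= e)%R by rewrite divr_ge0 ?sqr_ge0// ltW.
have -> : (l * (9 * t) = 9 / 8 * e)%R.
  by rewrite /l /e; field; rewrite gt_eqF.
have -> : (8 * (sigma ^+ 2 + 16 * m ^+ 2) * l ^+ 2 =
    e * ((sigma ^+ 2 + 16 * m ^+ 2) / (8 * D t)))%R.
  by rewrite /l /e; field; rewrite gt_eqF.
have : ((sigma ^+ 2 + 16 * m ^+ 2) / (8 * D t) <= 1 / 8)%R.
  rewrite ler_pdivrMr ?mulr_gt0//.
  have : (64 * m * m <= t * m)%R by rewrite ler_pM2r.
  rewrite /D expr2; lra.
move=> /(ler_wpM2l e0); lra.
Qed.

Variables (p a t l : R).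
Hypotheses (p2 : (2 <= p)%R) (t0 : (0 < t)%R) (mt : (64 * m <= t)%R).
Hypothesis iMp : \int[tprod mu n]_x poweR (max_envelope F x) p = a%:E.
Hypotheses (le : (expR 1 <= l)%R) (lm : (256 * l * m <= t)%R).
Hypothesis la :
  ((p / ln (expR 1 * p)) `^ p * (a / t `^ p) <= expR (- (2 * l)))%R.

(** Real-valued and capped so that [Yt y / t] lies in [0, 1], as [expR_interpolation] requires. It
    agrees with [Y] wherever the envelope is below [t], hence at all coordinates once the maximum
    is. *)
Let Yt y := if phi y <= rho%:E then 0%R else
  if phi y < t%:E then fine (phi y) else 0%R.

Let Yt_bounds y : (0 <= Yt y <= t)%R.
Proof.
rewrite /Yt; case: ifP => _; first by rewrite lexx ltW.
have := envelope_ge0 y; rewrite -/phi.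
case: ifPn => [|_ _]; last by rewrite lexx ltW.
by case: (phi y) => [r| |]//=; rewrite lte_fin lee_fin => /ltW rt ->.
Qed.

Let Yt_le y : (Yt y)%:E <= Y y.
Proof.
rewrite /Yt /Y; case: ifP => // _; have := envelope_ge0 y; rewrite -/phi.
by case: ifPn => // _; case: (phi y).
Qed.

Let bYt : bmeas Yt.
Proof.
split; last first.
  by exists t => y; have /andP[h1 h2] := Yt_bounds y; rewrite ger0_norm.
apply: measurable_fun_ifT => //; first exact: measurable_fun_lee.
apply: measurable_fun_ifT => //; first exact: measurable_fun_lte.
by apply: measurableT_comp => //.
Qed.

(** The linear term of the interpolation contributes at most [l] by [lm]. The power term contributes
    at most 2: [la] cancels the factor [expR (2 * l)], and the 2 is that of [Ymoment]. *)
Let exp_moment :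
  (n%:R * \int[mu]_y (expR (l / t * Yt y) - 1) <= l + 2)%R.
Proof.
have l0 : (0 < l)%R by apply: lt_le_trans le; exact: expR_gt0.
have tp0 : (0 < t `^ p)%R by rewrite powR_gt0.
have [y yE' [y0 ny]] := yE.
pose L := ((p / ln (expR 1 * p)) `^ p)%R.
have la' : (L * (a / t `^ p) <= expR (- (2 * l)))%R := la.
have L0 : (0 <= L)%R by exact: powR_ge0.
pose c := (expR (2 * l) * L / t `^ p)%R.
have c0 : (0 <= c)%R by rewrite divr_ge0 ?mulr_ge0 ?expR_ge0// ltW.
have bE : bmeas (fun y => expR (l / t * Yt y) - 1)%R by bm.
have mYp : measurable_fun setT (fun z => poweR (Y z) p).
  by apply: (@measurableT_comp _ _ _ _ _ _ (poweR^~ p) _ Y) => //; exact: measurable_poweR.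
rewrite -lee_fin EFinM -EFin_bmeas//.
have pt z : (expR (l / t * Yt z) - 1)%:E <=
    (l ^+ 2 / t)%:E * Y z + c%:E * poweR (Y z) p.
  have /andP[h1 h2] := Yt_bounds z.
  apply: (@le_trans _ _ ((l ^+ 2 / t) * Yt z + c * (Yt z) `^ p)%:E).
    have u0 : (0 <= Yt z / t)%R by rewrite divr_ge0// ltW.
    have u1 : (Yt z / t <= 1)%R by rewrite ler_pdivrMr// mul1r.
    have := expR_interpolation p l (Yt z / t)%R p2 le u0 u1.
    rewrite lee_fin (_ : (l * (Yt z / t) = l / t * Yt z)%R); last by ring.
    move=> /le_trans; apply.
    rewrite -/L powRM// ?invr_ge0 ?(ltW t0)//.
    have -> : (t^-1 `^ p = (t `^ p)^-1)%R by rewrite -powR_inv1 ?(ltW t0)// -powRrM mulN1r powRN.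
    rewrite le_eqVlt; apply/orP; left; apply/eqP; rewrite /c; ring.
  rewrite EFinD !EFinM; apply: leeD.
    by apply: lee_wpmul2l; rewrite ?lee_fin ?divr_ge0 ?sqr_ge0 ?(ltW t0)//.
  apply: lee_wpmul2l; first by rewrite lee_fin.
  rewrite -poweR_EFin; apply: gt0_ler_poweR; rewrite ?in_itv/= ?lee_fin ?leey ?h1//.
    by move: p2; lra.
  by rewrite Y0.
have p0 : (0 < p)%R by move: p2; lra.
have := Ymoment (poweR^~ p) (measurable_poweR _) (fun y _ => poweR_ge0 y p)
  (poweR0r (lt0r_neq0 p0)).
rewrite iMp => H.
have {H} iYp : n%:R%:E * \int[mu]_y poweR (Y y) p <= (2 * a)%:E.
  rewrite EFinM; apply: H => u v u0 uv.
  by apply: gt0_ler_poweR; rewrite ?in_itv/= ?leey ?u0 ?(le_trans u0 uv)// ltW.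
apply: (@le_trans _ _ (n%:R%:E * \int[mu]_z ((l ^+ 2 / t)%:E * Y z + c%:E * poweR (Y z) p))).
  apply: lee_wpmul2l; first by rewrite lee_fin.
  apply: ge0_le_integral => //.
  - move=> z _; rewrite lee_fin subr_ge0 -[leLHS]expR0 ler_expR.
    by have /andP[h1 h2] := Yt_bounds z; rewrite mulr_ge0// divr_ge0// ltW.
  - by apply/measurable_EFinP; case: bE.
  - by apply: emeasurable_funD; exact: emeasurable_funM.
have lt0 : (0 <= l ^+ 2 / t)%R by rewrite divr_ge0 ?sqr_ge0// ltW.
rewrite ge0_integralD//; last 4 first.
- by move=> z _; rewrite mule_ge0// lee_fin.
- exact: emeasurable_funM.
- by move=> z _; rewrite mule_ge0 ?lee_fin ?poweR_ge0.
- exact: emeasurable_funM.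
rewrite !ge0_integralZl//; try by move=> *; exact: poweR_ge0.
rewrite ge0_muleDr; last 2 first.
- by rewrite yE' -EFinM lee_fin mulr_ge0.
- by rewrite mule_ge0 ?lee_fin// integral_ge0// => z _; exact: poweR_ge0.
rewrite yE' (muleCA n%:R%:E c%:E).
apply: (@le_trans _ _ ((l ^+ 2 / t * (2 * m))%:E + c%:E * (2 * a)%:E)).
  apply: leeD; last by apply: lee_wpmul2l => //; rewrite lee_fin.
  by rewrite -!EFinM lee_fin mulrCA; apply: ler_wpM2l.
rewrite -EFinM -EFinD lee_fin.
have : (c * a <= 1)%R.
  have -> : (c * a = expR (2 * l) * (L * (a / t `^ p)))%R by rewrite /c; ring.
  by rewrite -ler_pdivlMl ?expR_gt0// mulr1 -expRN.
have : (l ^+ 2 / t * (2 * m) <= l)%R.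
  rewrite (_ : (_ * _ = l * (2 * l * m) / t)%R); last by field; rewrite gt_eqF.
  rewrite ler_pdivrMr// ler_pM2l//; move: lm (mulr_gt0 l0 m0); lra.
lra.
Qed.

Let Y_tail : tprod mu n [set x | (6 * t < \sum_(k < n) Yt (tnth x k))%R] <=
  (expR (2 - 4 * l))%:E.
Proof.
have l0 : (0 < l)%R by apply: lt_le_trans le; exact: expR_gt0.
have lt0 : (0 <= l / t)%R by rewrite divr_ge0// ltW.
apply: (le_trans (chernoff_tprod mu n Yt (l / t)%R (6 * t)%R bYt lt0)).
rewrite lee_fin ler_expR (_ : (l / t * (6 * t) = 6 * l)%R); last first.
  by field; rewrite gt_eqF.
have := exp_moment; lra.
Qed.

Lemma truncated_tail :
  tprod mu n [set x | 24%:E * (\int[tprod mu n]_y sup_sum F y + t%:E) <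
                      sup_sum F x] <=
  (expR (- (t ^+ 2 / (2 * sigma ^+ 2 + 64 * t * m))))%:E +
  tprod mu n [set x | t%:E <= max_envelope F x] + (expR (2 - 4 * l))%:E.
Proof.
have [z zE [zT z0]] := EZ_bounds.
rewrite zE.
set A := [set x | _ < sup_sum F x].
set A1 := [set x | (2 * (ET + 4 * m) + 9 * t < T x)%R].
set A2 := [set x | t%:E <= max_envelope F x].
set A3 := [set x | (6 * t < \sum_(k < n) Yt (tnth x k))%R].
have mR (f : n.-tuple S -> R) (c : R) : bmeas f -> measurable [set x | (c < f x)%R].
  move=> [/measurable_EFinP mf _].
  have := emeasurable_fun_o_infty measurableT mf c%:E.
  by rewrite setTI (_ : [set x | _] = [set x | (c < f x)%R]).
have mA1 : measurable A1 by exact: mR.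
have mA3 : measurable A3.
  apply: (mR (fun x => \sum_(k < n) Yt (tnth x k))%R).
  apply: bmeas_sum => k; apply: (bmeas_comp (fun x => tnth x k)) => //.
  exact: measurable_tnth.
have mA2 : measurable A2.
  by have := emeasurable_fun_c_infty measurableT mM t%:E; rewrite setTI.
have mA : measurable A.
  by have := emeasurable_fun_o_infty measurableT mZ (24%:E * (z%:E + t%:E)); rewrite setTI.
apply: (@le_trans _ _ (tprod mu n (A1 `|` A2 `|` A3))).
  apply: le_measure; rewrite ?inE//.
    by apply: measurableU => //; exact: measurableU.
  move=> x Ax; apply: contrapT => /not_orP[/not_orP[/negP nA1 /negP nA2] /negP nA3].
  rewrite -leNgt in nA1; rewrite -leNgt in nA3; rewrite -ltNge in nA2.
  have YE k : Y (tnth x k) = (Yt (tnth x k))%:E.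
    rewrite /Y /Yt; case: ifP => // _.
    have pt : phi (tnth x k) < t%:E by apply: le_lt_trans nA2; exact: envelope_le_max.
    rewrite pt; have := envelope_ge0 (tnth x k); rewrite -/phi.
    by move: pt; case: (phi _).
  have := Z_le x; rewrite /W.
  rewrite (eq_bigr (fun k => (2 * Yt (tnth x k))%:E)); last first.
    by move=> k _; rewrite YE -EFinD; congr EFin; ring.
  rewrite sumEFin -EFinD -mulr_sumr => h.
  have := lt_le_trans Ax h; rewrite -EFinD -EFinM lte_fin.
  (* Off the three events, Z is at most [2 * (ET + 4 * m) + 9 * t + 12 * t], hence at most
     [2 * z + 16 * m + 21 * t]. This is below [24 * (z + t)] because [22 * z >= - (176 * m)] and
     [192 * m <= 3 * t]. *)
  by apply/negP; rewrite -leNgt; move: nA1 nA3 zT z0 mt; lra.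
apply: (le_trans (measureU2 (tprod mu n) (measurableU _ _ mA1 mA2) mA3)).
apply: leeD; last exact: Y_tail.
apply: (le_trans (measureU2 (tprod mu n) mA1 mA2)).
by apply: leeD => //; exact: T_tail.
Qed.

End truncation.

(** * The law of the sample *)

Section law_of_sample.
Local Open Scope ereal_scope.
Context {d d'} {T : measurableType d} {S : measurableType d'} {R : realType}
  (P : probability T R).

Lemma measurable_sample n (X_ : 'I_n -> {RV P >-> S}) :
  measurable_fun [set: T] (sample X_).
Proof.
apply/measurable_fun_tnthP => k.
rewrite (_ : _ \o _ = X_ k)//.
by apply/funext => w /=; rewrite tnth_mktuple.
Qed.

Definition rectangle n (A : 'I_n -> set S) : set (n.-tuple S) :=
  [set x | forall k, A k (tnth x k)].

Lemma measurable_rectangle n (A : 'I_n -> set S) :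
  (forall k, measurable (A k)) -> measurable (rectangle n A).
Proof.
move=> mA; rewrite (_ : rectangle n A =
  \big[setI/setT]_(k <- enum 'I_n) ((fun x => tnth x k) @^-1` A k)).
  apply: bigsetI_measurable => k _; rewrite -[X in measurable X]setTI.
  by apply: measurable_tnth.
rewrite -bigcap_seq; apply/seteqP; split => x /= H k; first by move=> _; exact: H.
by apply: H; rewrite /= mem_enum.
Qed.

(** A cylinder over one coordinate is a rectangle with full sides elsewhere. Unlike cylinders,
    rectangles are stable under intersection, which the uniqueness theorem for measures needs. *)
Lemma measurable_tuple_rectangles n :
  @measurable _ (n.-tuple S) =
  <<s [set B | exists2 A : 'I_n -> set S, forall k, measurable (A k)
               & B = rectangle n A] >>.
Proof.
apply/seteqP; split; last first.
  apply: smallest_sub; first exact: sigma_algebra_measurable.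
  by move=> B [A mA ->]; exact: measurable_rectangle.
apply: smallest_sub; first exact: smallest_sigma_algebra.
move=> B; rewrite -bigcup_seq => -[k _ [A mA <-]].
apply: sub_sigma_algebra; exists (fun j => if j == k then A else setT).
  by move=> j; case: ifP.
rewrite setTI; apply/seteqP; split => x /=.
  by move=> Ax j; case: eqP => // ->.
by move=> /(_ k); rewrite eqxx.
Qed.

Lemma tprod_rectangle (mu : probability S R) n (A : 'I_n -> set S) :
  (forall k, measurable (A k)) ->
  tprod mu n (rectangle n A) = \big[*%E/1]_(k < n) mu (A k).
Proof.
move=> mA.
rewrite -[in LHS](setIT (rectangle n A)) -integral_indic//; last first.
  exact: measurable_rectangle.
rewrite (eq_bigr (fun k => \int[mu]_y (\1_(A k) y)%:E)); last first.
  by move=> k _; rewrite integral_indic ?setIT.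
rewrite -(ge0_integral_prod mu n (fun k y => (\1_(A k) y)%:E)).
- apply: eq_integral => x _; rewrite indicE.
  case: (boolP (x \in _)) => [/set_mem xA|/negP xA].
    by rewrite big1// => k _; rewrite indicE mem_set//; exact: xA.
  have /existsNP[k kA] : ~ forall k, A k (tnth x k).
    by move=> H; apply: xA; rewrite inE.
  by rewrite (bigD1 k)//= indicE memNset// mul0e.
- by move=> k; apply/measurable_EFinP; exact: measurable_indic.
- by move=> k y; rewrite lee_fin.
Qed.

Lemma distribution_sample n (X : {RV P >-> S}) (X_ : 'I_n -> {RV P >-> S})
    (B : set (n.-tuple S)) : iid_copies X X_ -> measurable B ->
  P (sample X_ @^-1` B) = tprod (distribution P X) n B.
Proof.
move=> [indep ident] mB.
pose s : {mfun T >-> n.-tuple S} := HB.pack (sample X_)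
  (isMeasurableFun.Build _ _ _ _ (sample X_) (measurable_sample n X_)).
pose Gr := [set B | exists2 A : 'I_n -> set S, forall k, measurable (A k)
               & B = rectangle n A].
have GT : Gr setT by exists (fun=> setT) => //; apply/seteqP; split.
apply: (@measure_unique _ R (n.-tuple S) Gr (fun=> setT) _ _ _ _
  (distribution P s) (tprod (distribution P X) n)) => //.
- exact: measurable_tuple_rectangles.
- move=> _ _ [A mA ->] [C mC ->]; exists (fun k => A k `&` C k).
    by move=> k; exact: measurableI.
  apply/seteqP; split => x /=; first by move=> [h1 h2] k; split; [exact: h1|exact: h2].
  by move=> h; split => k; case: (h k).
- by apply/seteqP; split => // x _; exists 0%N.
- move=> _ [A mA ->].
  apply: etrans (esym (tprod_rectangle (distribution P X) n A mA)).
  rewrite (eq_bigr (fun k => P (X_ k @^-1` A k))); last first.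
    by move=> k _; apply: esym; exact: (ident k _ (mA k)).
  rewrite -indep//; congr (P _); apply/seteqP; split => w /= h k.
    by have := h k; rewrite /sample tnth_mktuple.
  by rewrite /sample tnth_mktuple; exact: h.
- by move=> _; apply: (@le_lt_trans _ _ 1%E); [exact: sprobability_setT|exact: ltry].
Qed.

Lemma integral_sample n (X : {RV P >-> S}) (X_ : 'I_n -> {RV P >-> S})
    (h : n.-tuple S -> \bar R) : iid_copies X X_ -> measurable_fun setT h ->
  \int[P]_w h (sample X_ w) = \int[tprod (distribution P X) n]_x h x.
Proof.
move=> iid mh.
pose s : {mfun T >-> n.-tuple S} := HB.pack (sample X_)
  (isMeasurableFun.Build _ _ _ _ (sample X_) (measurable_sample n X_)).
have ge0 g : measurable_fun setT g -> (forall x, 0 <= g x) ->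
  \int[P]_w g (sample X_ w) = \int[tprod (distribution P X) n]_x g x.
  move=> mg g0; rewrite -(ge0_integral_distribution s)//.
  apply: eq_measure_integral => B mB _; exact: distribution_sample.
rewrite integralE [RHS]integralE; congr (_ - _).
  rewrite -(ge0 (funepos h)); [|exact: measurable_funepos|exact: funepos_ge0].
  by apply: eq_integral => w _; rewrite !funeposE.
rewrite -(ge0 (funeneg h)); [|exact: measurable_funeneg|exact: funeneg_ge0].
by apply: eq_integral => w _; rewrite !funenegE.
Qed.

Lemma integral_law (X : {RV P >-> S}) (h : S -> \bar R) :
  measurable_fun setT h ->
  \int[P]_w h (X w) = \int[distribution P X]_y h y.
Proof.
move=> mh; rewrite integralE [RHS]integralE; congr (_ - _).
  rewrite (ge0_integral_distribution X); [|exact: measurable_funepos|exact: funepos_ge0].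
    by apply: eq_integral => w _; rewrite /= !funeposE.
rewrite (ge0_integral_distribution X); [|exact: measurable_funeneg|exact: funeneg_ge0].
by apply: eq_integral => w _; rewrite /= !funenegE.
Qed.

End law_of_sample.

(** * The tail inequality *)

Section tail_on_tuples.
Local Open Scope ereal_scope.
Context {d} {S : measurableType d} {R : realType} (mu : probability S R).
Variables (n : nat) (F : set (S -> R)).
Hypotheses (n0 : (0 < n)%N) (F0 : F !=set0).
Hypothesis mF : forall f, F f -> measurable_fun [set: S] f.
Hypothesis cF : forall f, F f -> \int[mu]_y (f y)%:E = 0.
Hypothesis mM : measurable_fun [set: n.-tuple S] (@max_envelope _ S R n F).
Hypothesis mZ : measurable_fun [set: n.-tuple S] (@sup_sum _ S R n F).

Lemma sup_sum_le_max (x : n.-tuple S) : sup_sum F x <= n%:R%:E * max_envelope F x.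
Proof.
rewrite -sume_ord_const; apply: ge_ereal_sup => _ [f Ff <-].
rewrite -sumEFin; apply: lee_sum => k _.
apply: le_trans (envelope_le_max n F x k).
apply: le_trans (abs_le_envelope F f _ Ff).
by rewrite lee_fin ler_norm.
Qed.

Lemma sup_sum_ge_max (x : n.-tuple S) : - (n%:R%:E * max_envelope F x) <= sup_sum F x.
Proof.
have [f Ff] := F0.
apply: (@le_trans _ _ (\sum_(k < n) f (tnth x k))%R%:E); last first.
  by apply: ereal_sup_ubound; exists f.
rewrite leeNl -EFinN -sume_ord_const -sumrN -sumEFin.
apply: lee_sum => k _; apply: le_trans (envelope_le_max n F x k).
apply: le_trans (abs_le_envelope F f _ Ff).
by rewrite lee_fin -normrN ler_norm.
Qed.

(** Truncation at 8m needs m > 0. For m = 0 the bound [|Z| <= n * M] makes Z vanish almost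
    everywhere, and Markov's inequality makes the event null; this matters when [sigma = 0], where
    the exponential term is 0 as well. *)
Lemma degenerate_tail t : (0 < t)%R ->
  \int[tprod mu n]_x max_envelope F x = 0 ->
  tprod mu n [set x | 24%:E * (\int[tprod mu n]_y sup_sum F y + t%:E) <
                      sup_sum F x] = 0.
Proof.
move=> t0 M0.
have Mge0 := max_envelope_ge0 n F n0 F0.
have abs_le (x : n.-tuple S) : `|sup_sum F x| <= n%:R%:E * max_envelope F x.
  have := sup_sum_le_max x; have := sup_sum_ge_max x.
  rewrite leeNl; have [h _ hZ|h hZ _] := leP 0 (sup_sum F x).
    by rewrite gee0_abs.
  by rewrite lte0_abs.
have iabs : \int[tprod mu n]_x `|sup_sum F x| = 0.
  apply/eqP; rewrite eq_le; apply/andP; split; last exact: integral_ge0.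
  rewrite -[leRHS](mule0 n%:R%:E) -M0 -ge0_integralZl//.
  apply: ge0_le_integral => //.
  - exact: measurableT_comp.
  - exact: emeasurable_funM.
have iZ : \int[tprod mu n]_x sup_sum F x = 0.
  apply/eqP; rewrite -abse_eq0 eq_le abse_ge0 andbT -iabs.
  exact: le_abse_integral.
rewrite iZ add0e -EFinM.
set c := (24 * t)%R; have c0 : (0 < c)%R by rewrite mulr_gt0.
set A := [set x | _].
have mA : measurable A.
  by have := emeasurable_fun_o_infty measurableT mZ c%:E; rewrite setTI.
apply/eqP; rewrite eq_le measure_ge0 andbT.
have : c%:E * tprod mu n A <= 0.
  rewrite -iabs -[X in tprod mu n X]setIT -integral_indic// -ge0_integralZl//; last 2 first.
  - exact/measurable_EFinP/measurable_indic.
  - by rewrite lee_fin ltW.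
  apply: ge0_le_integral => //.
  - by move=> x _; rewrite mule_ge0// lee_fin// ltW.
  - by apply: emeasurable_funM => //; exact/measurable_EFinP/measurable_indic.
  - exact: measurableT_comp.
  - move=> x _; rewrite indicE; case: (boolP (x \in A)) => [/set_mem xA|_].
      rewrite mule1; apply: le_trans (lee_abs _); exact: ltW.
    by rewrite mule0.
by rewrite pmule_rle0 ?lte_fin.
Qed.

Lemma nondegenerate_tail (p sigma m a t : R) :
  (2 <= p)%R -> (0 < m)%R ->
  \int[tprod mu n]_x max_envelope F x = m%:E ->
  \int[tprod mu n]_x poweR (max_envelope F x) p = a%:E ->
  (forall f, F f -> n%:R%:E * \int[mu]_y ((f y) ^+ 2)%:E <= (sigma ^+ 2)%:E) ->
  (0 < t)%R ->
  tprod mu n [set x | 24%:E * (\int[tprod mu n]_y sup_sum F y + t%:E) <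
                      sup_sum F x] <=
  (1 + expR (4 * expR 1))%R%:E *
    ((expR (- (t ^+ 2 / (2 * sigma ^+ 2 + 64 * t * m))))%:E +
     tprod mu n [set x | t%:E <= max_envelope F x] +
     ((p / ln (expR 1 * p)) `^ (2 * p) * (a / t `^ p) ^+ 2)%R%:E).
Proof.
move=> p2 m0 iM iMp vF t0.
set D := (2 * sigma ^+ 2 + 64 * t * m)%R.
set E := expR (- (t ^+ 2 / D)).
set L := ((p / ln (expR 1 * p)) `^ p)%R.
have -> : ((p / ln (expR 1 * p)) `^ (2 * p) * (a / t `^ p) ^+ 2 =
    (L * (a / t `^ p)) ^+ 2)%R.
  by rewrite [(2 * p)%R]mulrC powRrM powR_mulrn ?powR_ge0// [RHS]exprMn.
set Q := ((L * (a / t `^ p)) ^+ 2)%R.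
set A := [set x | _ < _].
set B := [set x | _ <= _].
have mA : measurable A.
  by have := emeasurable_fun_o_infty measurableT mZ
       (24%:E * (\int[tprod mu n]_y sup_sum F y + t%:E)); rewrite setTI.
have tm0 : (0 < t * m)%R by rewrite mulr_gt0.
have sg2 := sqr_ge0 sigma.
have D0 : (0 < D)%R by rewrite /D; lra.
have E0 : (0 < E)%R by exact: expR_gt0.
have Q0 : (0 <= Q)%R by exact: sqr_ge0.
have e2 : (2 <= expR 1 :> R)%R by have := expR_ge1Dx (1 : R)%R; lra.
have B0 : 0 <= tprod mu n B by exact: measure_ge0.
have A1 : tprod mu n A <= 1 by exact: probability_le1.
have K1 : (1 <= 1 + expR (4 * expR 1) :> R)%R by rewrite lerDl expR_ge0.
set K := (1 + expR (4 * expR 1))%R in K1 *.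
have t2D : (t ^+ 2 / D <= t / (64 * m))%R.
  rewrite ler_pdivrMr// mulrAC ler_pdivlMr ?mulr_gt0//.
  have : (0 <= t * sigma ^+ 2)%R by rewrite mulr_ge0// ltW.
  rewrite /D !expr2; lra.
have trivial : (1 <= K * (E + Q))%R -> tprod mu n A <=
    K%:E * (E%:E + tprod mu n B + Q%:E).
  move=> h; apply: (le_trans A1); apply: (@le_trans _ _ (K%:E * (E%:E + Q%:E))).
    by rewrite -EFinD -EFinM lee_fin.
  apply: lee_wpmul2l; first by rewrite lee_fin; lra.
  by rewrite leeD2r// leeDl.
(* Below [64 * m] the exponent [t ^+ 2 / D] is at most 1, and [K >= expR 1] makes the right side at
   least 1. *)
have [mt|mt] := ltP t (64 * m)%R.
  apply: trivial.
  have : (expR (- 1) <= E)%R.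
    rewrite /E ler_expR lerN2; apply: (le_trans t2D).
    by rewrite ler_pdivrMr ?mulr_gt0// mul1r ltW.
  have : (expR 1 * expR (- 1) = 1 :> R)%R by rewrite -expRD subrr expR0.
  have : (expR 1 <= K)%R.
    have : (expR 1 <= expR (4 * expR 1) :> R)%R by rewrite ler_expR; lra.
    by rewrite /K; lra.
  have := expR_gt0 (- 1 : R)%R.
  nra.
set th := Num.max E Q.
have Eth : (E <= th)%R by rewrite le_max lexx.
have Qth : (Q <= th)%R by rewrite le_max lexx orbT.
have thEQ : (th <= E + Q)%R by rewrite ge_max; apply/andP; split; lra.
have th0 : (0 < th)%R by exact: lt_le_trans E0 Eth.
(* The threshold corresponds to [l = expR 1], the least [l] allowed in the interpolation; it
   dictates the constant [expR (4 * expR 1)] in [K]. *)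
have [hth|hth] := leP (expR (- (4 * expR 1))) th.
  apply: trivial.
  have : (expR (4 * expR 1) * expR (- (4 * expR 1)) = 1 :> R)%R.
    by rewrite -expRD subrr expR0.
  have : (expR (4 * expR 1) * expR (- (4 * expR 1)) <= expR (4 * expR 1) * th)%R.
    by rewrite ler_pM2l ?expR_gt0.
  have : (expR (4 * expR 1) * th <= expR (4 * expR 1) * (E + Q))%R.
    by rewrite ler_pM2l ?expR_gt0.
  rewrite /K; lra.
(* From [E <= th] one gets [4 * l <= t ^+ 2 / D <= t / (64 * m)], which is [lm]. As [Q] is a square,
   [Q <= th] bounds its root by [expR (- (2 * l))], which is [la]. The tail [expR (2 - 4 * l)] is
   then [expR 2 * th]. *)
pose l := (- ln th / 4)%R.
have thE : th = expR (- (4 * l)).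
  by rewrite /l (_ : (- (4 * (- ln th / 4)) = ln th)%R) ?lnK ?posrE//; field.
have le : (expR 1 <= l)%R.
  by move: hth; rewrite thE ltr_expR; lra.
have lm : (256 * l * m <= t)%R.
  have : (4 * l <= t ^+ 2 / D)%R.
    by move: Eth; rewrite /E thE ler_expR; lra.
  move=> /le_trans/(_ t2D); rewrite ler_pdivlMr ?mulr_gt0//; lra.
have a0 : (0 <= a)%R.
  by rewrite -lee_fin -iMp; apply: integral_ge0 => x _; exact: poweR_ge0.
have la : (L * (a / t `^ p) <= expR (- (2 * l)))%R.
  have LA0 : (0 <= L * (a / t `^ p))%R by rewrite mulr_ge0 ?powR_ge0// divr_ge0 ?powR_ge0.
  rewrite -ler_sqr ?nnegrE ?expR_ge0//; apply: (le_trans Qth).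
  by rewrite thE expr2 -expRD le_eqVlt; apply/orP; left; apply/eqP; congr expR; lra.
have [s0 s0_small] := exists_small mu n F m n0 F0 m0 mM iM.
have := truncated_tail mu n F m n0 F0 m0 mF cF mM mZ iM s0 s0_small sigma vF
  p a t l p2 t0 mt iMp le lm la.
rewrite -/A -/B -/D -/E => /le_trans; apply.
rewrite expRD -thE.
have e4 : (expR 2 <= expR (4 * expR 1) :> R)%R by rewrite ler_expR; lra.
have e20 := expR_gt0 (2 : R)%R.
apply: (@le_trans _ _ (K%:E * tprod mu n B + (K * (E + Q))%:E)).
  rewrite addeAC addeC; apply: leeD.
    by rewrite -[leLHS]mul1e lee_wpmul2r// lee_fin.
  rewrite -EFinD lee_fin.
  have : (expR 2 * th <= expR 2 * (E + Q))%R by rewrite ler_pM2l.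
  have : (expR 2 * (E + Q) <= expR (4 * expR 1) * (E + Q))%R.
    by rewrite ler_wpM2r//; lra.
  rewrite /K; lra.
rewrite (_ : E%:E + tprod mu n B + Q%:E = (E + Q)%:E + tprod mu n B); last first.
  by rewrite addeAC EFinD.
rewrite ge0_muleDr//; last by rewrite lee_fin; lra.
by rewrite -EFinM addeC.
Qed.

End tail_on_tuples.

Local Open Scope ereal_scope.

(* Division in the exponent is that of \bar R, where 0^-1 = +oo: if the
   denominator vanishes, the exponential is exp(-oo) = 0. *)
Theorem theorem2p3 (R : realType) :
  exists K : R, (0 < K)%R /\
  forall (d d' : measure_display) (T : measurableType d)
    (S : measurableType d') (P : probability T R)
    (F : set (S -> R)) (n : nat) (X : {RV P >-> S})
    (X_ : 'I_n -> {RV P >-> S}) (p sigma : R),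
  let M := fun w => max_envelope F (sample X_ w) in
  let Z := fun w => sup_sum F (sample X_ w) in
  (forall f, F f -> measurable_fun [set: S] f) ->
  (0 < n)%N ->
  iid_copies X X_ ->
  (forall f, F f -> 'E_P[f \o X] = 0) ->
  measurable_fun [set: n.-tuple S] (@max_envelope _ S R n F) ->
  measurable_fun [set: n.-tuple S] (@sup_sum _ S R n F) ->
  (2 <= p)%R ->
  \int[P]_w poweR (M w) p < +oo ->
  (0 <= sigma)%R ->
  n%:R%:E * ereal_sup [set 'E_P[fun w => (f (X w) ^+ 2)%R] | f in F]
    <= (sigma ^+ 2)%:E ->
  forall t : R, (0 < t)%R -> (Num.sqrt 2 * sigma <= t)%R ->
  P [set w | 24%:E * (\int[P]_w' Z w' + t%:E) < Z w] <=
  K%:E * (expeR (- ((t ^+ 2)%:E /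
                    ((2 * sigma ^+ 2)%:E + (64 * t)%:E * \int[P]_w M w)))
          + P [set w | t%:E <= M w]
          + (powR (p / ln (expR 1 * p)) (2 * p))%:E *
            ((\int[P]_w poweR (M w) p) / (powR t p)%:E) ^+ 2).
Proof.
exists (1 + expR (4 * expR 1))%R; split; first by rewrite ltr_wpDr ?expR_ge0.
move=> d d' T S P F n X X_ p sigma M Z mF n0 iid cF mM mZ p2 iMp sg0 vF t t0 _.
set K := (1 + _)%R.
have K0 : (0 <= K)%R by rewrite addr_ge0// expR_ge0.
pose mu := distribution P X.
have PE (Q : set (n.-tuple S)) : measurable Q ->
    P (sample X_ @^-1` Q) = tprod mu n Q.
  exact: distribution_sample.
have ZE : \int[P]_w Z w = \int[tprod mu n]_x sup_sum F x.
  exact: (integral_sample P n X X_ (@sup_sum _ S R n F) iid mZ).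
have ME : \int[P]_w M w = \int[tprod mu n]_x max_envelope F x.
  exact: (integral_sample P n X X_ (@max_envelope _ S R n F) iid mM).
have mMp : measurable_fun setT (fun x : n.-tuple S => poweR (max_envelope F x) p).
  by apply: (@measurableT_comp _ _ _ _ _ _ (poweR^~ p)) => //; exact: measurable_poweR.
have MpE : \int[P]_w poweR (M w) p = \int[tprod mu n]_x poweR (max_envelope F x) p.
  exact: (integral_sample P n X X_ (fun x => poweR (max_envelope F x) p) iid mMp).
have mA : measurable [set x : n.-tuple S |
    24%:E * (\int[tprod mu n]_y sup_sum F y + t%:E) < sup_sum F x].
  have := emeasurable_fun_o_infty measurableT mZ
       (24%:E * (\int[tprod mu n]_y sup_sum F y + t%:E)).
  by rewrite setTI.
have mB : measurable [set x : n.-tuple S | t%:E <= max_envelope F x].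
  by have := emeasurable_fun_c_infty measurableT mM t%:E; rewrite setTI.
rewrite ME MpE ZE.
rewrite (_ : P [set w | _ < Z w] = tprod mu n [set x : n.-tuple S |
    24%:E * (\int[tprod mu n]_y sup_sum F y + t%:E) < sup_sum F x]); last first.
  exact: PE mA.
rewrite (_ : P [set w | _ <= M w] = tprod mu n [set x : n.-tuple S |
    t%:E <= max_envelope F x]); last exact: PE mB.
have iMp0 : 0 <= \int[tprod mu n]_x poweR (max_envelope F x) p.
  by apply: integral_ge0 => x _; exact: poweR_ge0.
have tp0 : (0 < t `^ p)%R by rewrite powR_gt0.
move: iMp; rewrite MpE.
case iMpE : (\int[tprod mu n]_x poweR (max_envelope F x) p) iMp0 => [a| |]// a0 _.
have sqE : (a%:E / (t `^ p)%:E) ^+ 2 = ((a / t `^ p) ^+ 2)%:E.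
  by rewrite inver gt_eqF// -EFinM EFin_expe.
rewrite sqE -EFinM.
(* For an empty class the supremum is -oo, so the event on the left is empty. *)
have [F0|/nonemptyPn F0] := pselect (F !=set0); last first.
  rewrite (_ : [set x | _ < sup_sum F x] = set0); last first.
    apply/seteqP; split => // x /=.
    by rewrite /sup_sum F0 image_set0 ereal_sup0 ltNge leNye.
  rewrite measure0 mule_ge0 ?lee_fin// !adde_ge0 ?expeR_ge0 ?lee_fin//.
  by rewrite mulr_ge0 ?powR_ge0 ?sqr_ge0.
have Mge0 := max_envelope_ge0 n F n0 F0.
have cF' f : F f -> \int[mu]_y (f y)%:E = 0.
  move=> Ff; rewrite -(cF f Ff) unlock.
  by rewrite -(integral_law P X (EFin \o f))//; exact/measurable_EFinP/mF.
have vF' f : F f -> n%:R%:E * \int[mu]_y ((f y) ^+ 2)%:E <= (sigma ^+ 2)%:E.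
  move=> Ff; apply: le_trans vF; apply: lee_wpmul2l; first by rewrite lee_fin.
  apply: ereal_sup_ubound; exists f => //; rewrite unlock.
  rewrite (integral_law P X (fun y => (f y ^+ 2)%:E))//.
  by apply/measurable_EFinP; apply: measurable_funX; exact: mF.
(* The mean of M is finite because M is at most 1 plus its p-th power. *)
have : \int[tprod mu n]_x max_envelope F x < +oo.
  apply: (@le_lt_trans _ _ (\int[tprod mu n]_x (1 + poweR (max_envelope F x) p))).
    apply: ge0_le_integral => //; first by apply: emeasurable_funD.
    move=> x _; have := Mge0 x.
    case: (max_envelope F x) => [r| |]//; last first.
      by move=> _; rewrite poweRyr ?addey// gt_eqF//; lra.
    rewrite poweR_EFin !lee_fin => r0.
    have [r1|r1] := leP r 1%R; first by have := powR_ge0 r p; lra.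
    have : (r `^ 1 <= r `^ p)%R by rewrite ler_powR//; lra.
    by rewrite powRr1//; lra.
  rewrite ge0_integralD//; last by move=> x _; exact: poweR_ge0.
  rewrite iMpE integral_cst// mul1e.
  by rewrite (@le_lt_trans _ _ (1 + a%:E))// ?leeD2r ?sprobability_setT// -EFinD ltry.
have : 0 <= \int[tprod mu n]_x max_envelope F x by exact: integral_ge0.
case mE : (\int[tprod mu n]_x max_envelope F x) => [m| |]// m0 _.
have [m_eq0|m_neq0] := eqVneq m 0%R.
  rewrite degenerate_tail//; last by rewrite mE m_eq0.
  rewrite mule_ge0 ?lee_fin// !adde_ge0 ?expeR_ge0 ?lee_fin//.
  by rewrite mulr_ge0 ?powR_ge0 ?sqr_ge0.
have {m_neq0}m0 : (0 < m)%R by rewrite lt_def m_neq0.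
have D0 : (2 * sigma ^+ 2 + 64 * t * m != 0)%R.
  rewrite gt_eqF// ltr_wpDl ?mulr_ge0 ?sqr_ge0//.
  by rewrite !mulr_gt0.
rewrite -EFinM -EFinD inver (negbTE D0) -EFinM -EFinN /=.
exact: nondegenerate_tail.
Qed.
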